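(* Let $M=\Gamma\backslash\mathbf{H}^n$ be a non-compact hyperbolic manifold, let $C$ be the maximal representative of a cusp of $M$, and let $P\in M$ be a point of tangency of $C$ with itself, i.e. the image in $M$ of a point of tangency between two distinct horoballs of the preimage of $C$ in $\mathbf{H}^n$. Then $$\mathsf{R}(M)\;\ge\;\mathsf{r}_{inj}(P)\;\ge\;\mathrm{arccosh}(\sqrt5/2).$$ Moreover, when $M$ is the Gieseking manifold, equality holds between these quantities: $\mathsf{R}(M)=\mathsf{r}_{inj}(P)=\mathrm{arccosh}(\sqrt5/2)$.
   Context: A hyperbolic manifold is a manifold without boundary (not necessarily orientable) with a complete metric of constant curvature $-1$ and finite volume; $M=\Gamma\backslash\mathbf{H}^n$ with $\Gamma$ a discrete torsion-free group of isometries. $\mathsf{R}(M)$ is the radius of the largest embedded metric ball in $M$ (the maximum of the injectivity radius), and $\mathsf{r}_{inj}(P)$ is the injectivity radius at $P$. For $x\in\partial\mathbf{H}^n$ let $\Gamma_x$ be its stabilizer in $\Gamma$. A cusp region is a subset $\Gamma_x\backslash B_x\subset M$ where $B_x$ is an open horoball centered at a parabolic fixed point $x$ such that no $\gamma\in\Gamma\setminus\Gamma_x$ identifies two points of $B_x$. A cusp is an equivalence class of cusp regions for the relation ''one contains the other''; its maximal representative is the union of its elements. The Gieseking manifold is $\Gamma\backslash\mathbf{H}^3$ with $\Gamma$ generated (in the upper half-space model, $\omega=e^{i\pi/3}$) by the orientation-reversing isometries extending $z\mapsto(\bar z-1)/(-\omega)$ and $z\mapsto\omega\bar z/(\bar z+\omega)$;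 it is obtained by gluing the faces of a regular ideal tetrahedron in pairs and has a single cusp. *)

(* Defs.v *)
From HB Require Import structures.
From mathcomp Require Import all_boot all_order all_algebra.
From mathcomp Require Import all_classical all_reals all_analysis.
From mathcomp Require Import lra.
Set Implicit Arguments. Unset Strict Implicit. Unset Printing Implicit Defensive.
Import Order.TTheory GRing.Theory Num.Theory.
Import numFieldNormedType.Exports.
Local Open Scope classical_set_scope.
Local Open Scope ring_scope.

Definition acosh {R : realType} (x : R) : R := ln (x + Num.sqrt (x ^+ 2 - 1)).

(* A point of H^n, n = m+1, in the upper half-space model:
   (u, t) with u in R^m and t > 0. *)
Record hpt (R : realType) (m : nat) := HPt {
  hx : 'rV[R]_m ; hy : R ; hy_gt0 : 0 < hy }.

Section HypDefs.
Context {R : realType} {m : nat}.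
Local Notation pt := (hpt R m).

Definition esqd (p q : pt) : R :=
  \sum_(i < m) (hx p 0 i - hx q 0 i) ^+ 2 + (hy p - hy q) ^+ 2.

Definition hdist (p q : pt) : R :=
  acosh (1 + esqd p q / (2 * hy p * hy q)).

Definition isometry (f : pt -> pt) : Prop :=
  bijective f /\ forall p q, hdist (f p) (f q) = hdist p q.

Definition is_group (G : set (pt -> pt)) : Prop :=
  G id /\ (forall g h, G g -> G h -> G (g \o h)) /\
  (forall g, G g -> exists h, G h /\ h \o g = id /\ g \o h = id).

Definition isom_group (G : set (pt -> pt)) : Prop :=
  is_group G /\ forall g, G g -> isometry g.

(* discreteness: the identity is isolated for the compact-open topology
   (= topology of uniform convergence on compacta; closed balls are cofinal
   among compact sets) *)
Definition discrete_group (G : set (pt -> pt)) : Prop :=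
  exists (x0 : pt) (r eps : R), 0 < eps /\
    forall g, G g -> (forall y, hdist x0 y <= r -> hdist (g y) y < eps) -> g = id.

Definition torsion_free (G : set (pt -> pt)) : Prop :=
  forall g, G g -> forall k : nat, (0 < k)%N -> iter k g = id -> g = id.

Definition compact_quotient (G : set (pt -> pt)) : Prop :=
  exists (x0 : pt) (r : R), forall y, exists g, G g /\ hdist x0 (g y) <= r.

Definition coord_upd (v : nat -> R) (k : nat) (t : R) : nat -> R :=
  fun i => if i == k then t else v i.

Fixpoint iint (k : nat) (f : (nat -> R) -> \bar R) : \bar R :=
  match k with
  | 0 => f (fun _ => 0)
  | k.+1 => iint k (fun v => (\int[@lebesgue_measure R]_(t in setT) f (coord_upd v k t))%E)
  end.

Definition amb (F : set pt) : set ('rV[R]_m * R) :=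
  [set pr | exists h, F h /\ hx h = pr.1 /\ hy h = pr.2].

Definition hvol (F : set pt) : \bar R :=
  iint m.+1 (fun v => if `[< amb F (\row_(i < m) v i, v m) >]
                      then ((v m) ^- m.+1)%:E else 0%E).

Definition borel_amb (A : set ('rV[R]_m * R)) : Prop :=
  <<s [set U : set ('rV[R]_m * R) | open U] >> A.

Definition finite_volume (G : set (pt -> pt)) : Prop :=
  exists F : set pt,
    (forall p, exists g, G g /\ F (g p)) /\
    (forall p q, F p -> F q -> (exists g, G g /\ g p = q) -> p = q) /\
    borel_amb (amb F) /\ (hvol F < +oo)%E.

(* points at infinity: None = oo, Some a = (a,0) *)
Definition horoball (xi : option 'rV[R]_m) (s : R) : set pt :=
  match xi with
  | None => [set p | s < hy p]
  | Some a => [set p | \sum_(i < m) (hx p 0 i - a 0 i) ^+ 2 + (hy p - s) ^+ 2 < s ^+ 2]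
  end.

Definition is_horoball_at (xi : option 'rV[R]_m) (B : set pt) : Prop :=
  exists s, 0 < s /\ B = horoball xi s.

Definition is_horoball (B : set pt) : Prop := exists xi, is_horoball_at xi B.

(* the (boundary extension of the) isometry g fixes xi *)
Definition fixes_bd (g : pt -> pt) (xi : option 'rV[R]_m) : Prop :=
  forall B, is_horoball_at xi B -> is_horoball_at xi (g @` B).

Definition parabolic (g : pt -> pt) : Prop :=
  (forall p, g p <> p) /\ exists! xi, fixes_bd g xi.

Definition parabolic_fixed_point (G : set (pt -> pt)) (xi : option 'rV[R]_m) : Prop :=
  exists g, G g /\ parabolic g /\ fixes_bd g xi.

(* B is an open horoball at a parabolic fixed point xi such that no element
   of G outside the stabilizer G_xi identifies two points of B;
   the cusp region is G_xi\B *)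
Definition cusp_region (G : set (pt -> pt)) (xi : option 'rV[R]_m) (B : set pt) : Prop :=
  parabolic_fixed_point G xi /\ is_horoball_at xi B /\
  forall g, G g -> ~ fixes_bd g xi -> forall p, B p -> ~ B (g p).

(* preimage in H^n of the image of B in M *)
Definition gpre (G : set (pt -> pt)) (B : set pt) : set pt :=
  [set p | exists g, G g /\ B (g p)].

(* preimage in H^n of the maximal representative of the cusp of (xi0,B0):
   union of all cusp regions comparable (for inclusion) with that of (xi0,B0) *)
Definition max_cusp_lift (G : set (pt -> pt)) (xi0 : option 'rV[R]_m) (B0 : set pt) : set pt :=
  [set p | exists xi B, cusp_region G xi B /\
     (gpre G B `<=` gpre G B0 \/ gpre G B0 `<=` gpre G B) /\ gpre G B p].

(* the horoballs of a union of horoballs S: maximal horoballs contained in S *)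
Definition horoball_of (S H : set pt) : Prop :=
  is_horoball H /\ H `<=` S /\
  forall H', is_horoball H' -> H `<=` H' -> H' `<=` S -> H' = H.

Definition hclosure (H : set pt) (p : pt) : Prop :=
  forall e : R, 0 < e -> exists q, H q /\ hdist p q < e.

Definition tangency_point (G : set (pt -> pt)) (xi0 : option 'rV[R]_m) (B0 : set pt) (p : pt) : Prop :=
  exists H1 H2, H1 <> H2 /\
    horoball_of (max_cusp_lift G xi0 B0) H1 /\
    horoball_of (max_cusp_lift G xi0 B0) H2 /\
    hclosure H1 p /\ hclosure H2 p.

Definition rinj (G : set (pt -> pt)) (p : pt) : \bar R :=
  ereal_sup [set r%:E | r in [set r : R | 0 < r /\
     forall q q', hdist p q < r -> hdist p q' < r ->
       forall g, G g -> g q = q' -> q = q']].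

Definition maxrad (G : set (pt -> pt)) : \bar R := ereal_sup (range (rinj G)).

Definition generated_group (S : set (pt -> pt)) : set (pt -> pt) :=
  [set g | forall G : set (pt -> pt),
     G id -> S `<=` G -> (forall a b, G a -> G b -> G (a \o b)) ->
     (forall a b, G a -> b \o a = id -> a \o b = id -> G b) -> G g].

End HypDefs.

Section Gieseking.
Context {R : realType}.
Local Notation pt := (hpt R 2).

Definition re (p : pt) : R := hx p 0 ord0.
Definition im (p : pt) : R := hx p 0 ord_max.
Definition mkrow (a b : R) : 'rV[R]_2 := \row_(i < 2) if i == ord0 then a else b.

(* omega = e^{i pi/3} = 1/2 + i sqrt3/2 *)
Definition om_re : R := 1 / 2.
Definition om_im : R := Num.sqrt 3 / 2.

(* extension of z |-> (conj z - 1)/(-omega) = -(conj z - 1) * conj omega *)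
Definition gies1 (p : pt) : pt :=
  let wa := re p - 1 in let wb := - im p in
  let ua := - om_re in let ub := om_im in
  @HPt R 2 (mkrow (wa * ua - wb * ub) (wa * ub + wb * ua)) (hy p) (hy_gt0 p).

Lemma gies2_den_gt0 (p : pt) :
  0 < (re p + om_re) ^+ 2 + (- im p + om_im) ^+ 2 + hy p ^+ 2.
Proof.
have h1 := sqr_ge0 (re p + om_re); have h2 := sqr_ge0 (- im p + om_im).
have h3 : 0 < hy p ^+ 2 by rewrite exprn_gt0 // hy_gt0.
lra.
Qed.

Lemma gies2_t_gt0 (p : pt) :
  0 < hy p / ((re p + om_re) ^+ 2 + (- im p + om_im) ^+ 2 + hy p ^+ 2).
Proof. by rewrite divr_gt0 ?hy_gt0 ?gies2_den_gt0. Qed.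

(* Poincare extension of z |-> omega conj z / (conj z + omega):
   with w = conj z, (w,t) |-> ((omega w conj(w+omega) + omega t^2)/D, t/D),
   D = |w + omega|^2 + t^2 *)
Definition gies2 (p : pt) : pt :=
  let wa := re p in let wb := - im p in
  let sa := wa + om_re in let sb := wb + om_im in
  let D := sa ^+ 2 + sb ^+ 2 + hy p ^+ 2 in
  (* w * conj s + t^2 *)
  let ka := wa * sa + wb * sb + hy p ^+ 2 in
  let kb := wb * sa - wa * sb in
  (* omega * k *)
  let na := om_re * ka - om_im * kb in
  let nb := om_re * kb + om_im * ka in
  @HPt R 2 (mkrow (na / D) (nb / D)) (hy p / D) (gies2_t_gt0 p).

Definition gieseking_group : set (pt -> pt) :=
  generated_group [set gies1; gies2].

End Gieseking.

(* Main.v *)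
Require Import Defs.
From HB Require Import structures.
From mathcomp Require Import all_boot all_order all_algebra.
From mathcomp Require Import all_classical all_reals all_analysis.
From mathcomp Require Import ring lra zify.
Import Order.TTheory GRing.Theory Num.Theory.
Import numFieldNormedType.Exports.
Local Open Scope classical_set_scope.
Local Open Scope ring_scope.
Set Implicit Arguments. Unset Strict Implicit. Unset Printing Implicit Defensive.

(* In the hyperboloid model horoballs are null vectors h, and P is the tangency
   point of the disjoint horoballs h1, h2 with -<h1, h2> = 2 exactly when
   P = (h1 + h2) / 2. Hence cosh d(P, gP) is a quarter of the sum of the four
   numbers -<hi, g hj>, each of which is 0 (equal horoballs) or at least 2
   (disjoint ones); unless g fixes P at most one vanishes, so
   cosh d(P, gP) >= 3/2 = cosh (2 arccosh (sqrt 5 / 2)).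
   For the Gieseking group, the horoballs at the vertices of the ideal
   tetrahedron T generate an invariant lattice. Minimising the distance to the
   center of T over an orbit moves any point into T; there the four coordinates
   of a point satisfy a quadratic inequality saying that a face pairing or a
   unit translation in a cusp moves it by at most arccosh (3/2). The action is
   free because it preserves, modulo 4, an orientation of the edges of the
   tessellation that orders the vertices of each tetrahedron. *)

(** * Hyperbolic space in Minkowski coordinates *)

(** Isometries are given only as distance-preserving bijections and the maximal cusp only as a union
    of sets. Isometries become linear because they permute the functions [chd q], which span the
    linear forms. The horoballs of the union are recovered as suprema of concentric lifts: lifts
    with different centers are disjoint, so a connected horoball contained in the union stays within
    the lifts at one center. Freeness of the Gieseking group is the delicate point, since the
    symmetries of the regular tetrahedron fix points. An element fixing a point of T permutes the
    vertices spanning the smallest face through that point; as it preserves their order, it fixes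
    them. There are at least two of them, so what remains is to exclude a motion around a fixed
    edge, and the orientations of the edges towards the six neighbouring vertices do that. Reduction
    modulo 4 turns the invariance of the orientation into a finite computation. *)

Section Acosh.
Context {R : realType}.
Implicit Types c d x : R.

Lemma exprn2_sqrt_subr1 c : 1 <= c -> Num.sqrt (c ^+ 2 - 1) ^+ 2 = c ^+ 2 - 1.
Proof. by move=> h; rewrite sqr_sqrtr //; nra. Qed.

Lemma acosh_arg_ge1 c : 1 <= c -> 1 <= c + Num.sqrt (c ^+ 2 - 1).
Proof. by move=> h; have := sqrtr_ge0 (c ^+ 2 - 1); lra. Qed.

Lemma acosh_arg_gt0 c : 1 <= c -> 0 < c + Num.sqrt (c ^+ 2 - 1).
Proof. by move=> h; apply: lt_le_trans (acosh_arg_ge1 h); lra. Qed.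

Lemma le_acosh c d : 1 <= c -> 1 <= d -> (acosh c <= acosh d) = (c <= d).
Proof.
move=> hc hd; rewrite /acosh ler_ln ?posrE ?acosh_arg_gt0 //.
apply/idP/idP => h; last by rewrite lerD // ler_sqrt; nra.
rewrite leNgt; apply/negP => hlt.
have : Num.sqrt (d ^+ 2 - 1) <= Num.sqrt (c ^+ 2 - 1) by rewrite ler_sqrt; nra.
lra.
Qed.

Lemma lt_acosh c d : 1 <= c -> 1 <= d -> (acosh c < acosh d) = (c < d).
Proof. by move=> hc hd; rewrite ltNge le_acosh // -ltNge. Qed.

Lemma acosh1 : acosh (1 : R) = 0.
Proof. by rewrite /acosh expr1n subrr sqrtr0 addr0 ln1. Qed.

Lemma acosh_ge0 c : 1 <= c -> 0 <= acosh c.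
Proof. by move=> h; rewrite -acosh1 le_acosh. Qed.

(** The addition formula of cosh, since [Num.sqrt (c ^+ 2 - 1)] is the hyperbolic sine of
    [acosh c]. *)
Lemma acoshD c d : 1 <= c -> 1 <= d ->
  acosh c + acosh d =
  acosh (c * d + Num.sqrt (c ^+ 2 - 1) * Num.sqrt (d ^+ 2 - 1)).
Proof.
move=> hc hd; rewrite /acosh -lnM ?posrE ?acosh_arg_gt0 //; congr ln.
set s := Num.sqrt (c ^+ 2 - 1); set u := Num.sqrt (d ^+ 2 - 1).
have hs : s ^+ 2 = c ^+ 2 - 1 by rewrite exprn2_sqrt_subr1.
have hu : u ^+ 2 = d ^+ 2 - 1 by rewrite exprn2_sqrt_subr1.
have s0 : 0 <= s by exact: sqrtr_ge0.
have u0 : 0 <= u by exact: sqrtr_ge0.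
have -> : (c * d + s * u) ^+ 2 - 1 = (c * u + s * d) ^+ 2.
  have -> : (c * d + s * u) ^+ 2 - 1 =
    c ^+ 2 * d ^+ 2 + 2 * c * d * s * u + s ^+ 2 * u ^+ 2 - 1 by ring.
  have -> : (c * u + s * d) ^+ 2 =
    c ^+ 2 * u ^+ 2 + 2 * c * d * s * u + s ^+ 2 * d ^+ 2 by ring.
  by rewrite hs hu; ring.
rewrite sqrtr_sqr ger0_norm; first by ring.
by rewrite addr_ge0 // mulr_ge0 //; lra.
Qed.

Lemma sqrt5_ge2 : 2 <= Num.sqrt (5 : R).
Proof.
have -> : (2 : R) = Num.sqrt 4.
  by rewrite (_ : 4 = 2 ^+ 2 :> R) ?sqrtr_sqr ?ger0_norm //; ring.
by rewrite ler_sqrt //; lra.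
Qed.

Lemma sqr_sqrt5 : Num.sqrt (5 : R) ^+ 2 = 5.
Proof. by rewrite sqr_sqrtr. Qed.

Lemma acosh_sqrt5_double :
  acosh (Num.sqrt 5 / 2 : R) + acosh (Num.sqrt 5 / 2) = acosh (3 / 2).
Proof.
have h := sqrt5_ge2; have h2 := sqr_sqrt5.
rewrite acoshD; [|lra|lra]; congr acosh.
rewrite -!expr2 sqr_sqrtr; last by nra.
by rewrite exprMn h2; field.
Qed.

Lemma acosh_sqrt5_gt0 : 0 < acosh (Num.sqrt 5 / 2 : R).
Proof.
have h := sqrt5_ge2; have h2 := sqr_sqrt5.
by rewrite -acosh1 lt_acosh; nra.
Qed.

Lemma acosh_lt_expR c x : 1 <= c -> acosh c < x ->
  c + Num.sqrt (c ^+ 2 - 1) < expR x.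
Proof. by move=> hc h; rewrite -ltr_ln ?posrE ?acosh_arg_gt0 ?expR_gt0 ?expRK. Qed.

End Acosh.

Section Dot.
Context {R : realType} {m : nat}.
Implicit Types (u v w : 'rV[R]_m) (a k : R).

Definition dot u v : R := \sum_i u 0 i * v 0 i.

Lemma dotC u v : dot u v = dot v u.
Proof. by apply: eq_bigr => i _; rewrite mulrC. Qed.

Lemma dotDl u v w : dot (u + v) w = dot u w + dot v w.
Proof. by rewrite -big_split; apply: eq_bigr => i _; rewrite mxE mulrDl. Qed.

Lemma dotZl a u v : dot (a *: u) v = a * dot u v.
Proof. by rewrite mulr_sumr; apply: eq_bigr => i _; rewrite mxE mulrA. Qed.

Lemma dotNl u v : dot (- u) v = - dot u v.
Proof. by rewrite -scaleN1r dotZl mulN1r. Qed.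

Lemma dot0l v : dot 0 v = 0.
Proof. by apply: big1 => i _; rewrite mxE mul0r. Qed.

Lemma dotDr u v w : dot w (u + v) = dot w u + dot w v.
Proof. by rewrite dotC dotDl !(dotC w). Qed.

Lemma dotZr a u v : dot v (a *: u) = a * dot v u.
Proof. by rewrite dotC dotZl (dotC v). Qed.

Lemma dotNr u v : dot v (- u) = - dot v u.
Proof. by rewrite dotC dotNl (dotC v). Qed.

Lemma dot0r v : dot v 0 = 0.
Proof. by rewrite dotC dot0l. Qed.

Definition dotE := (dotDl, dotDr, dotNl, dotNr, dotZl, dotZr, dot0l, dot0r).

Lemma dot_ge0 u : 0 <= dot u u.
Proof. by apply: sumr_ge0 => i _; rewrite -expr2 sqr_ge0. Qed.

Lemma dot_eq0 u : dot u u = 0 -> u = 0.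
Proof.
move=> /eqP; rewrite psumr_eq0; last by move=> i _; rewrite -expr2 sqr_ge0.
move=> /allP h; apply/rowP => i; rewrite mxE.
have := h i; rewrite mem_index_enum => /(_ isT).
by rewrite -expr2 sqrf_eq0 => /eqP.
Qed.

Lemma dot_gt0 u : u != 0 -> 0 < dot u u.
Proof.
move=> h; rewrite lt0r dot_ge0 andbT; apply: contra h => /eqP h.
by apply/eqP; exact: dot_eq0.
Qed.

Lemma dot_CS u v : dot u v ^+ 2 <= dot u u * dot v v.
Proof.
have [->|v0] := eqVneq v 0; first by rewrite !dotE expr0n mulr0.
have hv := dot_gt0 v0.
have := dot_ge0 (dot v v *: u - dot u v *: v).
rewrite !dotE (dotC v u) => h.
rewrite -(ler_pM2l hv) -subr_ge0; apply: le_trans h _.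
by rewrite le_eqVlt; apply/orP; left; apply/eqP; ring.
Qed.

(** The deficit is that of [dot_CS] plus the squared norm of [k *: v - a *: u]. *)
Lemma scalar_dot_CS k a u v :
  (k * a + dot u v) ^+ 2 <= (k ^+ 2 + dot u u) * (a ^+ 2 + dot v v).
Proof.
have h1 := dot_CS u v.
have := dot_ge0 (k *: v - a *: u).
rewrite !dotE (dotC v u) => h2.
rewrite -subr_ge0.
have -> : (k ^+ 2 + dot u u) * (a ^+ 2 + dot v v) - (k * a + dot u v) ^+ 2 =
 (dot u u * dot v v - dot u v ^+ 2) +
 (k * (k * dot v v) + k * - (a * dot u v) + (- (a * (k * dot u v)) + - (a * - (a * dot u u)))) by ring.
by rewrite addr_ge0 ?subr_ge0 //; move: h2; congr (_ <= _); ring.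
Qed.

End Dot.

Section Lorentz.
Context {R : realType} {m : nat}.
Local Notation pt := (hpt R m).
Local Notation vec := (R * 'rV[R]_m * R)%type.
Implicit Types (p q r : pt) (v w : vec).

Lemma hpt_eq p q : hx p = hx q -> hy p = hy q -> p = q.
Proof.
case: p => x t ht; case: q => y s hs /= ex et.
by subst y s; rewrite (bool_irrelevance ht hs).
Qed.

Lemma hy_neq0 p : hy p != 0.
Proof. by rewrite gt_eqF ?hy_gt0. Qed.

Definition chd p q : R := 1 + esqd p q / (2 * hy p * hy q).

Lemma hdistE p q : hdist p q = acosh (chd p q).
Proof. by []. Qed.

Lemma esqdE p q :
  esqd p q = dot (hx p) (hx p) + dot (hx q) (hx q) - 2 * dot (hx p) (hx q)
             + (hy p - hy q) ^+ 2.
Proof.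
rewrite /esqd; congr (_ + _).
have -> : \sum_(i < m) (hx p 0 i - hx q 0 i) ^+ 2 = dot (hx p - hx q) (hx p - hx q).
  by apply: eq_bigr => i _; rewrite !mxE expr2.
by rewrite !dotE (dotC (hx q)); ring.
Qed.

Lemma esqd_ge0 p q : 0 <= esqd p q.
Proof. by rewrite addr_ge0 ?sqr_ge0 // sumr_ge0 // => i _; rewrite sqr_ge0. Qed.

Lemma chd_ge1 p q : 1 <= chd p q.
Proof.
by rewrite /chd lerDl divr_ge0 ?esqd_ge0 // !mulr_ge0 ?ltW ?hy_gt0.
Qed.

Lemma chdC p q : chd p q = chd q p.
Proof.
rewrite /chd !esqdE (dotC (hx q)); congr (1 + _ / _); last by ring.
by ring.
Qed.

Lemma chd_refl p : chd p p = 1.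
Proof.
rewrite /chd esqdE; set d := dot _ _.
by have -> : d + d - 2 * d + (hy p - hy p) ^+ 2 = 0; [ring | rewrite mul0r addr0].
Qed.

Lemma chd_le1 p q : chd p q <= 1 -> p = q.
Proof.
rewrite /chd gerDl pmulr_lle0; last by rewrite invr_gt0 !mulr_gt0 ?hy_gt0.
rewrite /esqd; set s := \sum_(i < m) _ => h.
have s0 : 0 <= s by rewrite sumr_ge0 // => i _; rewrite sqr_ge0.
have h2 := sqr_ge0 (hy p - hy q).
have e0 : s = 0 by lra.
have /eqP : (hy p - hy q) ^+ 2 = 0 by lra.
rewrite sqrf_eq0 subr_eq0 => /eqP ey.
apply: hpt_eq ey; apply/rowP => i; apply/eqP; rewrite -subr_eq0 -sqrf_eq0.
move/eqP: e0; rewrite psumr_eq0; last by move=> j _; rewrite sqr_ge0.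
by move=> /allP /(_ i); rewrite mem_index_enum => /(_ isT).
Qed.

Lemma hdist_ge0 p q : 0 <= hdist p q.
Proof. by rewrite acosh_ge0 ?chd_ge1. Qed.

Lemma hdist_refl p : hdist p p = 0.
Proof. by rewrite hdistE chd_refl acosh1. Qed.

Lemma hdistC p q : hdist p q = hdist q p.
Proof. by rewrite !hdistE chdC. Qed.

Lemma le_hdist p q (c : R) : 1 <= c -> (hdist p q <= acosh c) = (chd p q <= c).
Proof. by move=> h; rewrite hdistE le_acosh ?chd_ge1. Qed.

Lemma hdist_eq_chd p q p' q' : hdist p q = hdist p' q' -> chd p q = chd p' q'.
Proof.
rewrite !hdistE => h; apply: le_anti.
by rewrite -(le_acosh (chd_ge1 p q) (chd_ge1 p' q')) -(le_acosh (chd_ge1 p' q') (chd_ge1 p q)) h lexx.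
Qed.

(* The triple (a, b, c) stands for the function (a + b.x + c (|x|^2 + t^2)) / t
   of the point (x, t); these functions are the restrictions to the hyperboloid
   of the linear forms of Minkowski space, and [lform] is minus the Lorentz
   product. *)
Definition ev w p : R :=
  (w.1.1 + dot w.1.2 (hx p) + w.2 * (dot (hx p) (hx p) + hy p ^+ 2)) / hy p.

Definition lform v w : R := 2 * (v.1.1 * w.2 + v.2 * w.1.1) - dot v.1.2 w.1.2.

Definition ptvec p : vec :=
  ((dot (hx p) (hx p) + hy p ^+ 2) / (2 * hy p), - (hy p)^-1 *: hx p, (2 * hy p)^-1).

Lemma lformC v w : lform v w = lform w v.
Proof. by rewrite /lform (dotC v.1.2); ring. Qed.

Lemma lformDl u v w : lform (u + v) w = lform u w + lform v w.
Proof. by rewrite /lform /= !dotE; ring. Qed.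

Lemma lformDr u v w : lform w (u + v) = lform w u + lform w v.
Proof. by rewrite lformC lformDl !(lformC w). Qed.

Lemma lformNl v w : lform (- v) w = - lform v w.
Proof. by rewrite /lform /= !dotE; ring. Qed.

Lemma lformNr v w : lform v (- w) = - lform v w.
Proof. by rewrite lformC lformNl lformC. Qed.

Lemma lform_ptvec w p : lform w (ptvec p) = ev w p.
Proof.
rewrite /lform /ev /= !dotE; have := hy_neq0 p.
by move: (dot w.1.2 (hx p)) (dot (hx p) (hx p)) => b d h; field.
Qed.

Lemma ev_ptvec p q : ev (ptvec p) q = chd p q.
Proof.
rewrite /ev /chd /= !dotE esqdE; have := hy_neq0 p; have := hy_neq0 q.
by move: (dot _ _) (dot _ _) (dot _ _) => b d c h h'; field; rewrite h h'.
Qed.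

Lemma evDl v w p : ev (v + w) p = ev v p + ev w p.
Proof. by rewrite -!lform_ptvec lformDl. Qed.

Lemma evNl w p : ev (- w) p = - ev w p.
Proof. by rewrite -!lform_ptvec lformNl. Qed.

Lemma lform_ptvec_ptvec p : lform (ptvec p) (ptvec p) = 1.
Proof. by rewrite lform_ptvec ev_ptvec chd_refl. Qed.

(** Up to sign for [kperp], these are the derivatives of [ev w] at p along the orthonormal frame t
    d/dt, t d/dx, that is, the components of w orthogonal to [ptvec p]. *)
Definition kperp w p : R :=
  (w.1.1 + dot w.1.2 (hx p) + w.2 * dot (hx p) (hx p)) / hy p - w.2 * hy p.
Definition uperp w p := w.1.2 + (2 * w.2) *: hx p.

Lemma lform_perp v w p :
  ev v p * ev w p - lform v w = kperp v p * kperp w p + dot (uperp v p) (uperp w p).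
Proof.
rewrite /ev /lform /kperp /uperp !dotE (dotC (hx p) w.1.2); have := hy_neq0 p.
move: (dot _ _) (dot _ _) (dot _ _) (dot _ _) => a b c d h; field.
exact: h.
Qed.

(* The Cauchy-Schwarz inequality on the orthogonal complement of p, where the
   Lorentz form is definite. *)
Lemma lform_CS v w p :
  (ev v p * ev w p - lform v w) ^+ 2 <=
  (ev v p ^+ 2 - lform v v) * (ev w p ^+ 2 - lform w w).
Proof.
rewrite !(expr2 (ev _ _)) !lform_perp -!expr2.
exact: scalar_dot_CS.
Qed.

Lemma lform_le_sqr_ev w p : lform w w <= ev w p ^+ 2.
Proof. by rewrite -subr_ge0 expr2 lform_perp addr_ge0 ?dot_ge0 // -expr2 sqr_ge0. Qed.

Lemma lform_perp_eq0 w p : ev w p = 0 -> lform w w = 0 -> w = 0.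
Proof.
move=> h1 h2; have := lform_perp w w p; rewrite h1 h2 mul0r subr0 -expr2 => h.
have hk := sqr_ge0 (kperp w p); have hu := dot_ge0 (uperp w p).
have /eqP : kperp w p ^+ 2 = 0 by lra.
rewrite sqrf_eq0 => /eqP k0; have /dot_eq0 u0 : dot (uperp w p) (uperp w p) = 0 by lra.
have t0 := hy_gt0 p; move: h1 k0; rewrite /ev /kperp => h1 k0.
have h3 : w.2 * hy p = 0.
  have : w.2 * hy p + w.2 * hy p = 0.
    rewrite -[RHS](subrr 0) -{1}h1 -k0; field; exact: hy_neq0.
  lra.
have c0 : w.2 = 0 by move/eqP: h3; rewrite mulf_eq0 (negbTE (hy_neq0 p)) orbF => /eqP.
have b0 : w.1.2 = 0 by move: u0; rewrite /uperp c0 mulr0 scale0r addr0.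
move: h1; rewrite c0 b0 dot0l mul0r !addr0 => /eqP.
rewrite mulf_eq0 invr_eq0 (negbTE (hy_neq0 p)) orbF => /eqP a0.
by case: w a0 b0 c0 {h2 h hk hu u0 k0 h3} => -[a b] c /= -> -> ->.
Qed.

(** [lform_CS] at the middle point q bounds [chd p r] by the cosh of the sum of the two
    distances. *)
Lemma hdist_triangle p q r : hdist p r <= hdist p q + hdist q r.
Proof.
have h1 := chd_ge1 p q; have h2 := chd_ge1 q r.
rewrite !hdistE acoshD // le_acosh ?chd_ge1 //; last first.
  have : 0 <= Num.sqrt (chd p q ^+ 2 - 1) * Num.sqrt (chd q r ^+ 2 - 1).
    by rewrite mulr_ge0 ?sqrtr_ge0.
  nra.
have := lform_CS (ptvec p) (ptvec r) q.
rewrite !lform_ptvec !ev_ptvec !chd_refl (chdC r q) => h.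
rewrite -sqrtrM; last by nra.
rewrite -lerBlDl; apply: le_trans (ler_norm _) _.
rewrite -sqrtr_sqr ler_sqrt; last first.
  by apply: mulr_ge0; nra.
by apply: le_trans h; rewrite -sqrrN opprB.
Qed.

(* The factor is exp (hdist p q). *)
Lemma null_ev_le w p q : lform w w = 0 -> 0 < ev w p -> 0 < ev w q ->
  ev w p <= (chd p q + Num.sqrt (chd p q ^+ 2 - 1)) * ev w q.
Proof.
move=> w0 hp hq; have hC := chd_ge1 p q.
have := lform_CS w (ptvec p) q.
rewrite lform_ptvec lform_ptvec_ptvec w0 ev_ptvec subr0 => h.
set s := Num.sqrt _; have s0 : 0 <= s by exact: sqrtr_ge0.
have hs : s ^+ 2 = chd p q ^+ 2 - 1 by rewrite exprn2_sqrt_subr1.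
rewrite -hs -exprMn in h.
have : `|ev w q * chd p q - ev w p| <= ev w q * s.
  have := h; rewrite -ler_sqrt; last by rewrite sqr_ge0.
  by rewrite !sqrtr_sqr (ger0_norm (mulr_ge0 (ltW hq) s0)).
by rewrite ler_norml => /andP[]; lra.
Qed.

Lemma null_ev_le2 w p q : lform w w = 0 -> 0 < ev w p -> 0 < ev w q ->
  ev w p <= 2 * chd p q * ev w q.
Proof.
move=> w0 hp hq; have hC := chd_ge1 p q.
apply: le_trans (null_ev_le w0 hp hq) _; rewrite ler_pM2r //.
suff : Num.sqrt (chd p q ^+ 2 - 1) <= chd p q by lra.
rewrite -[leRHS](ger0_norm (_ : 0 <= chd p q)); last by lra.
by rewrite -sqrtr_sqr ler_sqrt ?sqr_ge0 //; lra.
Qed.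

(** The point p is w normalised to length 1; positivity of [w.2] selects the sheet of the
    hyperboloid. *)
Lemma timelike_point w : 0 < w.2 -> 0 < lform w w ->
  exists p, forall v, ev v p = lform v w / Num.sqrt (lform w w).
Proof.
move=> c0 D0; set D := lform w w; set s := Num.sqrt D.
have s0 : 0 < s by rewrite sqrtr_gt0.
have sD : s ^+ 2 = D by rewrite sqr_sqrtr // ltW.
have t0 : 0 < s / (2 * w.2) by rewrite divr_gt0 // mulr_gt0.
exists (HPt (- (2 * w.2)^-1 *: w.1.2) t0) => v; rewrite /ev /= !dotE.
have : D = 4 * w.1.1 * w.2 - dot w.1.2 w.1.2 by rewrite /D /lform; ring.
rewrite -sD => h; have {h}-> : dot w.1.2 w.1.2 = 4 * w.1.1 * w.2 - s ^+ 2 by lra.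
by rewrite /lform (dotC v.1.2); field; rewrite !gt_eqF.
Qed.

End Lorentz.

(** * Horoballs and the action of isometries on the boundary *)

Section Boundary.
Context {R : realType} {m : nat}.
Local Notation pt := (hpt R m).
Local Notation vec := (R * 'rV[R]_m * R)%type.
Local Notation bpt := (option 'rV[R]_m).
Implicit Types (p q : pt) (v w : vec) (xi eta : bpt) (c d k : R) (g : pt -> pt).

Let half_gt0 c : 0 < c -> 0 < c / 2.
Proof. by move=> h; rewrite divr_gt0. Qed.

Definition svec k w : vec := (k * w.1.1, k *: w.1.2, k * w.2).

Lemma lform_svecl k v w : lform (svec k v) w = k * lform v w.
Proof. by rewrite /lform /= !dotE; ring. Qed.

Lemma lform_svecr k v w : lform v (svec k w) = k * lform v w.
Proof. by rewrite lformC lform_svecl lformC. Qed.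

Lemma ev_svec k w p : ev (svec k w) p = k * ev w p.
Proof. by rewrite -!lform_ptvec lform_svecl. Qed.

Definition bvec xi : vec :=
  if xi is Some a then (dot a a, - 2 *: a, 1) else (1, 0, 0).

Arguments bvec : simpl never.

(** Makes the horoballs at all boundary points sublevel sets that grow with c, whereas the parameter
    of [horoball] is a Euclidean radius at finite points and a height at infinity. *)
Definition hb xi c : set pt := [set p | ev (bvec xi) p < c].

Lemma ev_bvecN p : ev (bvec None) p = (hy p)^-1.
Proof. by rewrite /ev /bvec /= !dotE !mul0r !addr0 mul1r. Qed.

Lemma ev_bvecS a p : ev (bvec (Some a)) p =
  (dot (hx p - a) (hx p - a) + hy p ^+ 2) / hy p.
Proof.
rewrite /ev /bvec /= !dotE (dotC a); congr (_ / _); ring.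
Qed.

Lemma ev_bvec_gt0 xi p : 0 < ev (bvec xi) p.
Proof.
case: xi => [a|]; last by rewrite ev_bvecN invr_gt0 hy_gt0.
rewrite ev_bvecS divr_gt0 ?hy_gt0 // ltr_wpDl ?dot_ge0 //.
by rewrite exprn_gt0 ?hy_gt0.
Qed.

Lemma lform_bvec_self xi : lform (bvec xi) (bvec xi) = 0.
Proof. by case: xi => [a|]; rewrite /lform /bvec /= !dotE; ring. Qed.

Lemma lform_bvecNS a : lform (bvec None) (bvec (Some a)) = 2.
Proof. by rewrite /lform /bvec /= !dotE; ring. Qed.

Lemma lform_bvecSS a b : lform (bvec (Some a)) (bvec (Some b)) = 2 * dot (a - b) (a - b).
Proof. by rewrite /lform /bvec /= !dotE (dotC b a); ring. Qed.

Lemma lform_bvec_gt0 xi eta : xi <> eta -> 0 < lform (bvec xi) (bvec eta).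
Proof.
case: xi eta => [a|] [b|] // h; rewrite ?(lformC _ (bvec None)) ?lform_bvecNS //.
rewrite lform_bvecSS mulr_gt0 // dot_gt0 // subr_eq0.
by apply/eqP => e; apply: h; rewrite e.
Qed.

Lemma ev_bvec_surj xi d : 0 < d -> exists p, ev (bvec xi) p = d.
Proof.
move=> d0; case: xi => [a|].
  exists (HPt a d0); rewrite ev_bvecS /= subrr !dotE add0r.
  by rewrite expr2 mulfK // gt_eqF.
have d1 : 0 < d^-1 by rewrite invr_gt0.
by exists (HPt 0 d1); rewrite ev_bvecN invrK.
Qed.

Lemma horoballS a d : horoball (Some a) d = hb (Some a) (2 * d).
Proof.
apply/funext => p; apply/propext; rewrite /horoball /hb /mkset.
have t0 := hy_gt0 p; rewrite ev_bvecS ltr_pdivrMr //.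
have -> : \sum_(i < m) (hx p 0 i - a 0 i) ^+ 2 = dot (hx p - a) (hx p - a).
  by apply: eq_bigr => i _; rewrite !mxE expr2.
by split; nra.
Qed.

Lemma horoballN d : 0 < d -> horoball None d = hb None d^-1.
Proof.
move=> d0; apply/funext => p; apply/propext; rewrite /horoball /hb /mkset.
by rewrite ev_bvecN ltf_pV2 ?posrE ?hy_gt0.
Qed.

Lemma is_horoball_atP xi (B : set pt) :
  is_horoball_at xi B <-> exists c, 0 < c /\ B = hb xi c.
Proof.
case: xi => [a|]; split=> [[s [s0 ->]]|[c [c0 ->]]].
- by exists (2 * s); rewrite horoballS; split=> //; lra.
- exists (c / 2); rewrite horoballS (_ : 2 * (c / 2) = c); last by field.
  by split=> //; lra.
- by exists s^-1; rewrite horoballN // invr_gt0.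
- by exists c^-1; rewrite horoballN ?invrK invr_gt0.
Qed.

Lemma hb_is_horoball xi c : 0 < c -> is_horoball (hb xi c).
Proof. by move=> c0; exists xi; apply/is_horoball_atP; exists c. Qed.

(** Along a vertical geodesic ending at xi, the horofunction at xi tends to 0 and the one at eta to
    infinity. *)
Lemma bvec_unbounded xi eta c k : xi <> eta -> 0 < c ->
  exists p, ev (bvec xi) p < c /\ k < ev (bvec eta) p.
Proof.
move=> ne c0.
pose k' := Num.max k 1; have k1 : 1 <= k' by rewrite le_max lexx orbT.
have kk : k <= k' by rewrite le_max lexx.
suff [p [h1 h2]] : exists p, ev (bvec xi) p < c /\ k' < ev (bvec eta) p.
  by exists p; split=> //; apply: le_lt_trans h2.
clear kk; clearbody k'; clear k; rename k' into k.
case: xi eta ne => [a|] [b|] // ne.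
- have D0 : 0 < dot (a - b) (a - b).
    by have := lform_bvec_gt0 ne; rewrite lform_bvecSS; lra.
  have [t /andP[t0 ht]] : exists t, 0 < t < Num.min c (dot (a - b) (a - b) / k).
    exists (Num.min c (dot (a - b) (a - b) / k) / 2).
    have : 0 < Num.min c (dot (a - b) (a - b) / k).
      by rewrite lt_min c0 divr_gt0 //; lra.
    by move=> h; apply/andP; split; lra.
  move: ht; rewrite lt_min => /andP[tc td].
  exists (HPt a t0); rewrite !ev_bvecS /= subrr !dotE add0r expr2 mulfK ?gt_eqF //.
  split=> //; rewrite ltr_pdivlMr //.
  rewrite ltr_pdivlMr in td; last by lra.
  rewrite !dotE in td; have := sqr_ge0 t; rewrite expr2; lra.
- have [t /andP[t0 ht]] : exists t, 0 < t < Num.min c (k^-1).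
    exists (Num.min c (k^-1) / 2).
    have : 0 < Num.min c (k^-1) by rewrite lt_min c0 invr_gt0 //; lra.
    by move=> h; apply/andP; split; lra.
  move: ht; rewrite lt_min => /andP[tc td].
  exists (HPt a t0); rewrite ev_bvecS ev_bvecN /= subrr !dotE add0r expr2 mulfK ?gt_eqF //.
  split=> //; rewrite -(invrK k) ltf_pV2 // posrE ?invr_gt0 //; lra.
- have t0 : 0 < k + 1 + c^-1 by rewrite !addr_gt0 // ?invr_gt0 //; lra.
  exists (HPt b t0); rewrite ev_bvecS ev_bvecN /= subrr !dotE add0r expr2 mulfK ?gt_eqF //.
  have ci : 0 < c^-1 by rewrite invr_gt0.
  split; last by lra.
  by rewrite -{2}(invrK c) ltf_pV2 ?posrE //; lra.
Qed.

Lemma hb_sub xi eta c d : 0 < c -> hb xi c `<=` hb eta d -> xi = eta /\ c <= d.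
Proof.
move=> c0 h.
have e : xi = eta.
  apply: contrapT => ne; have [p [h1 h2]] := bvec_unbounded d ne c0.
  by have := h p h1; rewrite /hb /= ltNge (ltW h2).
split=> //; subst eta; rewrite leNgt; apply/negP => dc.
have [d0|d0] := ltP 0 d.
  by have [p hp] := ev_bvec_surj xi d0; have := h p; rewrite /hb /= hp ltxx => /(_ dc).
have [p hp] := ev_bvec_surj xi (half_gt0 c0).
have := ev_bvec_gt0 xi p; have := h p; rewrite /hb /= hp.
move=> hh; have : c / 2 < d by apply: hh; lra.
lra.
Qed.

Lemma hb_inj xi eta c d : 0 < c -> 0 < d -> hb xi c = hb eta d -> xi = eta /\ c = d.
Proof.
move=> c0 d0 e.
have [e1 e2] : xi = eta /\ c <= d by apply: hb_sub => //; rewrite e.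
have [_ e3] : eta = xi /\ d <= c by apply: hb_sub => //; rewrite e.
by split=> //; apply: le_anti; rewrite e2 e3.
Qed.

(* A metric characterisation of the null vectors, hence isometry-invariant. *)
Lemma positive_vec_classify w : (forall p, 0 < ev w p) ->
  (forall e, 0 < e -> exists p, ev w p < e) ->
  exists xi k, 0 < k /\ forall p, ev w p = k * ev (bvec xi) p.
Proof.
case: w => -[a b] c hpos hinf.
have evp (x : 'rV[R]_m) t (t0 : 0 < t) :
    0 < a + dot b x + c * (dot x x + t ^+ 2).
  by have := hpos (HPt x t0); rewrite /ev /= pmulr_lgt0 // invr_gt0.
have c0 : 0 <= c.
  rewrite leNgt; apply/negP => c0.
  pose t := 1 + `|a| / - c.
  have t1 : 1 <= t by rewrite /t lerDl divr_ge0 ?normr_ge0 //; lra.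
  have t0 : 0 < t by lra.
  have := evp 0 t t0; rewrite !dotE add0r addr0.
  have h1 : - c * t = - c + `|a| by rewrite /t; field; lra.
  have h2 : c * t ^+ 2 <= c * t.
    by rewrite ler_nM2l // expr2 ler_pMr.
  have := ler_norm a; lra.
have [c00|cn] := eqVneq c 0.
  subst c.
  have b0 : b = 0.
    apply: contrapT => /eqP b0; have D := dot_gt0 b0.
    have := evp (- ((`|a| + 1) / dot b b) *: b) 1 ltr01.
    rewrite mul0r addr0 dotZr mulNr divfK ?gt_eqF //.
    have := ler_norm a; lra.
  subst b; have := evp 0 1 ltr01; rewrite mul0r dot0r !addr0 => a0.
  exists None, a; split=> // p; rewrite /ev /bvec /= !dotE !mul0r !addr0 mulrA.
  by rewrite mulr1.
have cp : 0 < c by rewrite lt0r cn c0.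
(* Completing the square. Since [lform w w] is 4 c k, the sign of k tells spacelike, null and
   timelike apart; a spacelike form vanishes somewhere above [x0]. *)
pose x0 := - (2 * c)^-1 *: b; pose k := a - dot b b / (4 * c).
have evE p : ev (a, b, c) p =
    (k + c * (dot (hx p - x0) (hx p - x0) + hy p ^+ 2)) / hy p.
  rewrite /ev /k /x0 /= !dotE (dotC (hx p) b); congr (_ / _).
  by field.
have k0 : 0 <= k.
  rewrite leNgt; apply/negP => k0.
  have t0 : 0 < Num.sqrt (- k / (2 * c)) by rewrite sqrtr_gt0 divr_gt0 //; lra.
  have := hpos (HPt x0 t0); rewrite evE /= subrr !dotE add0r.
  rewrite sqr_sqrtr; last by rewrite divr_ge0 //; lra.
  rewrite pmulr_lgt0 ?invr_gt0 //.
  rewrite (_ : c * _ = - k / 2); first by lra.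
  by field.
have [k00|kn] := eqVneq k 0.
  exists (Some x0), c; split=> // p.
  by rewrite evE k00 add0r ev_bvecS mulrA.
have kp : 0 < k by rewrite lt0r kn k0.
(* For k > 0 the arithmetic-geometric mean inequality keeps the function above 2 e, so its infimum
   is not 0. *)
pose e := Num.sqrt (k * c).
have e0 : 0 < e by rewrite sqrtr_gt0 mulr_gt0.
have ee : e ^+ 2 = k * c by rewrite sqr_sqrtr // ltW // mulr_gt0.
have [p] := hinf e e0; rewrite evE ltr_pdivrMr ?hy_gt0 // => hp.
have D0 : 0 <= c * dot (hx p - x0) (hx p - x0) by rewrite mulr_ge0 ?dot_ge0.
have h1 : k + c * hy p ^+ 2 < e * hy p by rewrite mulrDr in hp; lra.
have t0 := hy_gt0 p; exfalso.
have : (k + c * hy p ^+ 2) ^+ 2 < (e * hy p) ^+ 2.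
  have : 0 < k + c * hy p ^+ 2 by rewrite addr_gt0 // mulr_gt0 // exprn_gt0.
  by move=> h2; rewrite ltr_pXn2r // nnegrE; lra.
rewrite exprMn ee => h3.
have := sqr_ge0 (k - c * hy p ^+ 2).
have : 0 <= k * c * hy p ^+ 2 by rewrite !mulr_ge0 ?sqr_ge0 // ltW.
have -> : (k - c * hy p ^+ 2) ^+ 2 = (k + c * hy p ^+ 2) ^+ 2 - 4 * (k * c * hy p ^+ 2) by ring.
lra.
Qed.

(* These functions are the linear combinations of the functions chd q, which
   isometries permute. *)
Lemma isometry_linear g w : Defs.isometry g -> exists w', forall p, ev w (g p) = ev w' p.
Proof.
move=> [[f fK gK] gd].
pose P (F : pt -> R) := exists w', forall p, F (g p) = ev w' p.
have PD F H : P F -> P H -> P (fun p => F p + H p).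
  by move=> [u hu] [v hv]; exists (u + v) => p; rewrite evDl hu hv.
have PZ k F : P F -> P (fun p => k * F p).
  by move=> [u hu]; exists (svec k u) => p; rewrite ev_svec hu.
have P0 : P (fun=> 0).
  by exists (0, 0, 0) => p; rewrite /ev /= dot0l !mul0r !addr0 mul0r.
have Pchd q : P (chd q).
  exists (ptvec (f q)) => p; rewrite ev_ptvec; apply: hdist_eq_chd.
  by rewrite -(gd (f q)) gK.
have Peq F H : (forall p, F p = H p) -> P F -> P H.
  by move=> e [u hu]; exists u => p; rewrite -e.
have chd0 t (t0 : 0 < t) p :
    chd (HPt 0 t0) p = (dot (hx p) (hx p) + hy p ^+ 2 + t ^+ 2) / (2 * t * hy p).
  rewrite -ev_ptvec /ev /= !dotE; have := hy_neq0 p; have : t != 0 by rewrite gt_eqF.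
  by move=> h h'; field; rewrite h h'.
(* The points (0, 1) and (0, 2) yield 1/t and (|x|^2 + t^2)/t, the points (e_i, 1) then yield x_i/t,
   and these functions span all [ev w]. *)
have Pa : P (fun p => (hy p)^-1).
  have l2 : 0 < 2 :> R by [].
  apply: Peq (PD _ _ (PZ (4 / 3) _ (Pchd (HPt 0 l2))) (PZ (- (2 / 3)) _ (Pchd (HPt 0 ltr01)))) => p.
  by rewrite !chd0; have := hy_neq0 p; move: (dot _ _) => d h; field.
have Pc : P (fun p => (dot (hx p) (hx p) + hy p ^+ 2) / hy p).
  apply: Peq (PD _ _ (PZ 2 _ (Pchd (HPt 0 ltr01))) (PZ (- 1) _ Pa)) => p.
  by rewrite !chd0; have := hy_neq0 p; move: (dot _ _) => d h; field.
have Px i : P (fun p => hx p 0 i / hy p).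
  have := PD _ _ (PZ (1 / 2) _ Pc) (PD _ _ Pa (PZ (- 1) _ (Pchd (HPt (delta_mx 0 i) ltr01)))).
  apply: Peq => p; rewrite -ev_ptvec /ev /= !dotE.
  have e (u : 'rV[R]_m) : dot (delta_mx 0 i) u = u 0 i.
    rewrite /dot (bigD1 i) //= big1 ?addr0; last first.
      by move=> j ji; rewrite mxE eqxx (negbTE ji) mul0r.
    by rewrite mxE !eqxx mul1r.
  rewrite !e mxE !eqxx /= mulr1n; have := hy_neq0 p; move: (dot _ _) => d h; field.
  exact: h.
have Pb b : P (fun p => dot b (hx p) / hy p).
  apply: (Peq (fun p => \sum_i b 0 i * (hx p 0 i / hy p))).
    by move=> p; rewrite /dot mulr_suml; apply: eq_bigr => i _; rewrite mulrA.
  elim: (index_enum _) => [|i s IH]; first by apply: Peq P0 => p; rewrite big_nil.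
  by apply: Peq (PD _ _ (PZ (b 0 i) _ (Px i)) IH) => p; rewrite big_cons.
suff : P (ev w) by [].
apply: Peq (PD _ _ (PZ w.1.1 _ Pa) (PD _ _ (Pb w.1.2) (PZ w.2 _ Pc))) => p.
by rewrite /ev; field; exact: hy_neq0.
Qed.

Lemma isometry_inv g f : Defs.isometry g -> cancel f g -> cancel g f -> Defs.isometry f.
Proof.
move=> [_ gd] fK gK; split; first by exists g.
by move=> p q; rewrite -gd !fK.
Qed.

(** Pulled back by the inverse of g, a horofunction is still linear, positive and of infimum 0, so
    [positive_vec_classify] recognises it as a multiple of a horofunction. *)
Lemma isometry_boundary g xi : Defs.isometry g ->
  exists eta k, 0 < k /\ forall p, ev (bvec eta) (g p) = k * ev (bvec xi) p.
Proof.
move=> hg; have [[f fK gK] gd] := hg.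
have hf : Defs.isometry f by apply: isometry_inv hg gK fK.
have [w hw] := isometry_linear (bvec xi) hf.
have [eta [k [k0 hk]]] : exists eta k, 0 < k /\ forall p, ev w p = k * ev (bvec eta) p.
  apply: positive_vec_classify => [p|e e0]; first by rewrite -hw ev_bvec_gt0.
  have [p hp] := ev_bvec_surj xi (half_gt0 e0).
  by exists (g p); rewrite -hw fK hp; lra.
exists eta, k^-1; split; first by rewrite invr_gt0.
move=> p; rewrite -[in RHS](fK p) hw hk mulrA mulVf ?mul1r // gt_eqF //.
Qed.

Lemma bvec_proportional xi eta k : 0 < k ->
  (forall p, ev (bvec eta) p = k * ev (bvec xi) p) -> xi = eta.
Proof.
move=> k0 h; have : hb xi 1 `<=` hb eta k.
  by move=> p; rewrite /hb /= h gtr_pMr.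
by move=> /(hb_sub ltr01)[].
Qed.

(** Otherwise the sum of the null vectors scaled by 1/c and 1/d, normalised to a point, would lie in
    both horoballs. *)
Lemma hb_disjoint_form xi eta c d : 0 < c -> 0 < d ->
  (forall p, hb xi c p -> ~ hb eta d p) ->
  2 * c * d <= lform (bvec xi) (bvec eta).
Proof.
move=> c0 d0 dis.
have ne : xi <> eta.
  move=> e; subst eta.
  have m0 : 0 < Num.min c d by rewrite lt_min c0 d0.
  have [p hp] := ev_bvec_surj xi (half_gt0 m0).
  have mcd : Num.min c d / 2 < Num.min c d by lra.
  by apply: (dis p); rewrite /hb /= hp; apply: lt_le_trans mcd _; rewrite ge_min lexx ?orbT.
have F0 := lform_bvec_gt0 ne; set F := lform _ _ in F0 *.
rewrite leNgt; apply/negP => Flt.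
pose w := svec c^-1 (bvec xi) + svec d^-1 (bvec eta).
have c1 : 0 < c^-1 by rewrite invr_gt0.
have d1 : 0 < d^-1 by rewrite invr_gt0.
have w2 : 0 < w.2.
  rewrite /w /= /bvec; case: xi eta ne {dis F0 Flt F w} => [a|] [b|] // _ /=; rewrite ?mulr1 ?mulr0; lra.
have wl : lform w (bvec xi) = d^-1 * F.
  by rewrite lformDl !lform_svecl lform_bvec_self mulr0 add0r lformC.
have wr : lform w (bvec eta) = c^-1 * F.
  by rewrite lformDl !lform_svecl lform_bvec_self mulr0 addr0.
have ww : lform w w = 2 * (c^-1 * d^-1 * F).
  by rewrite {2}/w lformDr !lform_svecr wl wr; ring.
have W0 : 0 < lform w w by rewrite ww !mulr_gt0.
have [p hp] := timelike_point w2 W0.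
have s0 : 0 < Num.sqrt (lform w w) by rewrite sqrtr_gt0.
have ss : Num.sqrt (lform w w) ^+ 2 = lform w w by rewrite sqr_sqrtr // ltW.
have lt2 : lform w w < 2 * Num.sqrt (lform w w).
  have : lform w w < 4.
    rewrite ww; have : c^-1 * d^-1 * F < 2.
      by rewrite -invfM mulrC ltr_pdivrMr ?mulr_gt0 //; lra.
    lra.
  rewrite -{1 2}ss; move: (Num.sqrt _) s0 => s s0 s4.
  have : s < 2 by rewrite ltNge; apply/negP => s2; nra.
  by rewrite expr2 ltr_pM2r.
apply: (dis p); rewrite /hb /= hp lformC ?wl ?wr ltr_pdivrMr //.
  have -> : d^-1 * F = c * (lform w w / 2) by rewrite ww; field; rewrite ?gt_eqF.
  by rewrite ltr_pM2l //; lra.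
have -> : c^-1 * F = d * (lform w w / 2) by rewrite ww; field; rewrite ?gt_eqF.
by rewrite ltr_pM2l //; lra.
Qed.

(* The vector u + v - 2 p is forced to be orthogonal to p and not spacelike,
   hence zero. *)
Lemma tangency_midpoint u v p : lform u u = 0 -> lform v v = 0 -> 2 <= lform u v ->
  0 < ev u p <= 1 -> 0 < ev v p <= 1 ->
  forall w, ev w p = (lform w u + lform w v) / 2.
Proof.
move=> uu vv uv /andP[u0 u1] /andP[v0 v1] w.
pose W := u + v - ptvec p - ptvec p.
have eW : ev W p = ev u p + ev v p - 2.
  by rewrite /W !evDl !evNl !ev_ptvec chd_refl; ring.
have fW : lform W W = 2 * lform u v + 4 - 4 * (ev u p + ev v p).
  rewrite /W !(lformDl, lformDr, lformNl, lformNr) uu vv lform_ptvec_ptvec.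
  by rewrite !(lformC (ptvec p)) !lform_ptvec (lformC v u); ring.
have := lform_le_sqr_ev W p; rewrite fW eW => h.
have e2 : ev u p + ev v p = 2 by nra.
have W0 : W = 0 by apply: lform_perp_eq0 (_ : ev W p = 0) _; rewrite ?eW ?fW; nra.
have : lform w W = 0 by rewrite W0 /lform /= !dotE; ring.
by rewrite /W !(lformDr, lformNr) lform_ptvec; lra.
Qed.

Lemma hclosure_hb xi c p : hclosure (hb xi c) p -> ev (bvec xi) p <= c.
Proof.
move=> h.
have key (e : R) : 0 < e -> ev (bvec xi) p <= expR e * c.
  move=> /h[q [hq dq]].
  apply: le_trans (null_ev_le (lform_bvec_self xi) (ev_bvec_gt0 xi p) (ev_bvec_gt0 xi q)) _.
  apply: ler_pM.
  - by apply: ltW; apply: acosh_arg_gt0; rewrite chd_ge1.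
  - exact/ltW/ev_bvec_gt0.
  - by apply: ltW; apply: acosh_lt_expR => //; rewrite chd_ge1.
  - exact: ltW.
have c0 : 0 < c by have [q [hq _]] := h 1 ltr01; apply: lt_trans hq; exact: ev_bvec_gt0.
rewrite leNgt; apply/negP => lt.
have r1 : 1 < ev (bvec xi) p / c by rewrite ltr_pdivlMr // mul1r.
have l0 : 0 < ln (ev (bvec xi) p / c) by rewrite ln_gt0.
have := key _ (half_gt0 l0); rewrite -ler_pdivrMr // => h1.
have : expR (ln (ev (bvec xi) p / c) / 2) < ev (bvec xi) p / c.
  rewrite -[X in _ < X]lnK ?posrE; last by lra.
  by rewrite ltr_expR; lra.
lra.
Qed.

End Boundary.
Arguments bvec : simpl never.

(** * Maximal horoballs and tangency points *)

Section HoroballFamily.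
Context {R : realType} {m : nat}.
Local Notation pt := (hpt R m).
Local Notation bpt := (option 'rV[R]_m).
Implicit Types (p q r o : pt) (xi eta zeta : bpt) (c d e k s : R).

Lemma bvec2_ge0 xi : 0 <= (bvec xi).2.
Proof. by case: xi => [a|]; rewrite /bvec /=. Qed.

Lemma open_quadratic_lt0 (a b c : R) : open [set s : R | a * s ^+ 2 + b * s + c < 0].
Proof.
have -> : [set s : R | a * s ^+ 2 + b * s + c < 0] =
    (horner (a *: 'X^2 + b *: 'X + c%:P)) @^-1` [set x | x < 0].
  by apply/funext => s; rewrite /preimage /mkset !hornerE.
apply: open_comp; last exact: open_lt.
by move=> x _; apply: continuous_horner.
Qed.

Lemma segment_point p q s : 0 <= s <= 1 -> exists r,
  hx r = hx p + s *: (hx q - hx p) /\ hy r = hy p + s * (hy q - hy p).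
Proof.
move=> /andP[s0 s1].
have t0 : 0 < hy p + s * (hy q - hy p).
  have := hy_gt0 p; have := hy_gt0 q => h1 h2.
  have [->|ne] := eqVneq s 0; first by lra.
  have : 0 < s * hy q by rewrite mulr_gt0 // lt0r ne.
  have : 0 <= (1 - s) * hy p by rewrite mulr_ge0 //; lra.
  lra.
by exists (HPt (hx p + s *: (hx q - hx p)) t0).
Qed.

(** Coefficients, in the parameter s of the Euclidean segment from p to q, of the horofunction minus
    d, multiplied by the height. The leading one is nonnegative, whence the convexity of
    horoballs. *)
Definition segq2 xi p q := (bvec xi).2 *
  (dot (hx q - hx p) (hx q - hx p) + (hy q - hy p) ^+ 2).
Definition segq1 xi d p q := dot (bvec xi).1.2 (hx q - hx p) +
  2 * (bvec xi).2 * (dot (hx p) (hx q - hx p) + hy p * (hy q - hy p)) -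
  d * (hy q - hy p).
Definition segq0 xi d p := (bvec xi).1.1 + dot (bvec xi).1.2 (hx p) +
  (bvec xi).2 * (dot (hx p) (hx p) + hy p ^+ 2) - d * hy p.

Lemma hb_segment xi d p q r s :
  hx r = hx p + s *: (hx q - hx p) -> hy r = hy p + s * (hy q - hy p) ->
  hb xi d r = (segq2 xi p q * s ^+ 2 + segq1 xi d p q * s + segq0 xi d p < 0) :> Prop.
Proof.
move=> ex et; rewrite /hb /mkset; congr is_true.
rewrite /ev ltr_pdivrMr ?hy_gt0 // -subr_lt0; congr (_ < _).
by rewrite ex et /segq2 /segq1 /segq0 !dotE (dotC (hx q) (hx p)); ring.
Qed.

Lemma hb_convex xi d p q r s : 0 <= s <= 1 ->
  hx r = hx p + s *: (hx q - hx p) -> hy r = hy p + s * (hy q - hy p) ->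
  hb xi d p -> hb xi d q -> hb xi d r.
Proof.
move=> /andP[s0 s1] ex et.
rewrite (hb_segment xi d ex et) (@hb_segment xi d p q p 0); [|by rewrite scale0r addr0|by rewrite mul0r addr0].
rewrite (@hb_segment xi d p q q 1); [|by rewrite scale1r addrC subrK|by rewrite mul1r addrC subrK].
have : 0 <= segq2 xi p q by rewrite mulr_ge0 ?bvec2_ge0 // addr_ge0 ?dot_ge0 ?sqr_ge0.
move: (segq2 _ _ _) (segq1 _ _ _ _) (segq0 _ _ _) => A B C A0.
rewrite !expr2 !mulr0 !add0r !mulr1 => C0 C1.
have h1 : 0 <= A * (s * (1 - s)) by rewrite !mulr_ge0 //; lra.
have [->|ne] := eqVneq s 0; first by lra.
have h2 : 0 < s * - (A + B + C) by rewrite mulr_gt0 ?lt0r ?ne //; lra.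
have h3 : 0 <= (1 - s) * - C by rewrite mulr_ge0 //; lra.
lra.
Qed.

Context (Phi : bpt -> R -> Prop).
Context (Phi_gt0 : forall xi d, Phi xi d -> 0 < d).
Context (Phi_disj : forall xi eta c d p,
  Phi xi c -> Phi eta d -> hb xi c p -> hb eta d p -> xi = eta).

(** [Phi] is a relation, not a function, because nested cusp regions produce several concentric
    horoballs; only members with different centers are disjoint. *)
Definition fam_union : set pt := [set p | exists xi d, Phi xi d /\ hb xi d p].

(* Horoballs are connected, and the unions of the members of the family at each
   boundary point form an open partition of the union. *)
Lemma fam_connected zeta e p q xi d : hb zeta e `<=` fam_union ->
  hb zeta e p -> hb zeta e q -> Phi xi d -> hb xi d p ->
  exists d', Phi xi d' /\ hb xi d' q.
Proof.
move=> sub hp hq Pd hdp.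
pose C := \bigcup_(c in [set c | Phi xi c])
  [set s : R | segq2 xi p q * s ^+ 2 + segq1 xi c p q * s + segq0 xi c p < 0].
pose C' := \bigcup_(x in [set x : bpt * R | Phi x.1 x.2 /\ x.1 <> xi])
  [set s : R | segq2 x.1 p q * s ^+ 2 + segq1 x.1 x.2 p q * s + segq0 x.1 x.2 p < 0].
have oC : open C by apply: bigcup_open => c _; apply: open_quadratic_lt0.
have oC' : open C' by apply: bigcup_open => c _; apply: open_quadratic_lt0.
have P0 : hx p = hx p + 0 *: (hx q - hx p) by rewrite scale0r addr0.
have P0' : hy p = hy p + 0 * (hy q - hy p) by rewrite mul0r addr0.
have P1 : hx q = hx p + 1 *: (hx q - hx p) by rewrite scale1r addrC subrK.
have P1' : hy q = hy p + 1 * (hy q - hy p) by rewrite mul1r addrC subrK.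
have dis s : `[0, 1]%classic s -> C s -> C' s -> False.
  rewrite /= in_itv /= => s01 [c /= Pc hc] [[eta c'] /= [Pc' ne] hc'].
  have [r [ex et]] := segment_point p q s01.
  apply: ne; apply: (Phi_disj (p := r)) Pc' Pc _ _.
    by rewrite (hb_segment _ _ ex et).
  by rewrite (hb_segment _ _ ex et).
have cov s : `[0, 1]%classic s -> C s \/ C' s.
  rewrite /= in_itv /= => s01; have [r [ex et]] := segment_point p q s01.
  have /sub[eta [c [Pc hc]]] := hb_convex s01 ex et hp hq.
  rewrite (hb_segment _ _ ex et) in hc.
  have [e1|ne] := pselect (eta = xi).
    by left; exists c => //=; rewrite -e1.
  by right; exists (eta, c).
have I0 : `[0, 1]%classic (0 : R) by rewrite /= in_itv /= lexx ler01.
have I1 : `[0, 1]%classic (1 : R) by rewrite /= in_itv /= lexx ler01.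
have C0 : C 0 by exists d => //; rewrite /mkset -(hb_segment _ _ P0 P0').
have CI : `[0, 1]%classic `&` C = `[0, 1]%classic.
  apply: (@segment_connected R 0 1).
  - by exists 0.
  - by exists C.
  - exists (~` C'); first exact: open_closedC.
    apply/seteqP; split=> s [s01 hs]; split=> //; first by move/(dis _ s01 hs).
    by case: (cov _ s01).
have : (`[0, 1]%classic `&` C) 1 by rewrite CI.
case=> _ [d1 Pd1 hd1]; exists d1; split=> //.
by rewrite (hb_segment _ _ P1 P1').
Qed.

(** The horoball is covered by members with one common center xi. If xi were not zeta, these members
    would have unbounded size and reach the point o. *)
Lemma fam_base zeta e : (exists o, ~ fam_union o) -> 0 < e ->
  hb zeta e `<=` fam_union -> exists d, Phi zeta d.
Proof.
move=> [z no] e0 sub.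
have [p hp] := ev_bvec_surj zeta (divr_gt0 e0 (ltr0Sn R 1)).
have hpe : hb zeta e p by rewrite /hb /mkset hp; lra.
have [xi [d [Pd hd]]] := sub p hpe.
have [<-|ne] := pselect (xi = zeta); first by exists d.
have [q [hq lq]] := bvec_unbounded (ev (bvec xi) z) (fun h => ne (esym h)) e0.
have [d' [Pd' hd']] := fam_connected sub hpe hq Pd hd.
exfalso; apply: no; exists xi, d'; split=> //.
exact: lt_trans hd'.
Qed.

(** In the whole space no horoball is maximal, as each can be doubled. *)
Lemma maximal_horoball_proper H : horoball_of fam_union H -> exists o, ~ fam_union o.
Proof.
move=> [[zeta /is_horoball_atP[e [e0 ->]]] [sub maxH]]; apply: contrapT => no.
have all o : fam_union o by apply: contrapT => h; apply: no; exists o.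
have e2 : 0 < 2 * e by lra.
have : hb zeta (2 * e) = hb zeta e.
  apply: maxH => //; first exact: hb_is_horoball.
  by move=> p; rewrite /hb /mkset; lra.
by move=> /(hb_inj e2 e0)[_]; lra.
Qed.

(** By connectedness H lies in the members at xi, whose union is the horoball of supremal size;
    maximality gives equality. A point outside the union bounds the sizes. *)
Lemma maximal_horoballE H p xi d : horoball_of fam_union H -> H p ->
  Phi xi d -> hb xi d p -> H = hb xi (sup [set c | Phi xi c]).
Proof.
move=> mH; have [z no] := maximal_horoball_proper mH.
case: mH => [[zeta /is_horoball_atP[e [e0 ->]]] [sub maxH]] hp Pd hd.
have bnd : has_ubound [set c | Phi xi c].
  exists (ev (bvec xi) z) => c Pc; rewrite leNgt; apply/negP => lt.
  by apply: no; exists xi, c.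
have ne : [set c | Phi xi c] !=set0 by exists d.
have le_sup c : Phi xi c -> c <= sup [set c | Phi xi c] by move=> Pc; apply: ub_le_sup.
symmetry; apply: maxH.
- by apply: hb_is_horoball; apply: lt_le_trans (le_sup _ Pd); apply: Phi_gt0 Pd.
- move=> q hq; have [d' [Pd' hd']] := fam_connected sub hp hq Pd hd.
  exact: lt_le_trans (le_sup _ Pd').
- move=> q hq; have [c Pc hc] := sup_gt ne hq.
  by exists xi, c.
Qed.

Lemma maximal_horoball_eq H1 H2 p :
  horoball_of fam_union H1 -> horoball_of fam_union H2 -> H1 p -> H2 p -> H1 = H2.
Proof.
move=> m1 m2 h1 h2; have [xi [d [Pd hd]]] := m1.2.1 p h1.
by rewrite (maximal_horoballE m1 h1 Pd hd) (maximal_horoballE m2 h2 Pd hd).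
Qed.

End HoroballFamily.

Lemma mean4_ge {R : realFieldType} (x y z w : R) :
  x = 0 \/ 2 <= x -> y = 0 \/ 2 <= y -> z = 0 \/ 2 <= z -> w = 0 \/ 2 <= w ->
  (x = 0 -> y = 0 -> False) -> (x = 0 -> z = 0 -> False) -> (x = 0 -> w = 0 -> False) ->
  (y = 0 -> z = 0 -> False) -> (y = 0 -> w = 0 -> False) -> (z = 0 -> w = 0 -> False) ->
  3 / 2 <= ((x + y) / 2 + (z + w) / 2) / 2.
Proof.
move=> [hx|hx] [hy|hy] [hz|hz] [hw|hw] xy xz xw yz yw zw;
  by [have := xy hx hy|have := xz hx hz|have := xw hx hw|have := yz hy hz
     |have := yw hy hw|have := zw hz hw|clear xy xz xw yz yw zw; lra].
Qed.

(** * Lifts of a cusp, displacement of a tangency point, and injectivity radius *)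

Section Cusp.
Context {R : realType} {m : nat}.
Local Notation pt := (hpt R m).
Local Notation bpt := (option 'rV[R]_m).
Implicit Types (p q r o : pt) (xi eta zeta : bpt) (c d e k s : R) (g : pt -> pt).

(** The boundary extension of g maps xi to eta; the factor k records how sizes of horoballs change
    on the way. *)
Definition bdmap g xi eta k :=
  0 < k /\ forall p, ev (bvec eta) (g p) = k * ev (bvec xi) p.

Lemma bdmap_inv g f xi eta k : cancel f g ->
  bdmap g xi eta k -> bdmap f eta xi k^-1.
Proof.
move=> fK [k0 h]; split; first by rewrite invr_gt0.
by move=> p; rewrite -[in RHS](fK p) h mulKf // gt_eqF.
Qed.

Lemma bdmap_comp f g xi eta zeta k d :
  bdmap f xi eta k -> bdmap g eta zeta d -> bdmap (g \o f) xi zeta (d * k).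
Proof.
move=> [k0 hk] [d0 hd]; split; first exact: mulr_gt0.
by move=> p; rewrite /= hd hk mulrA.
Qed.

Lemma bdmap_inj g xi eta zeta k d :
  bdmap g xi zeta k -> bdmap g eta zeta d -> xi = eta.
Proof.
move=> [k0 hk] [d0 hd].
apply: (@bvec_proportional _ _ xi eta (d^-1 * k)); first by rewrite mulr_gt0 ?invr_gt0.
by move=> p; rewrite -mulrA -hk hd mulKf // gt_eqF.
Qed.

Lemma bdmap_hb g xi eta k c p : bdmap g xi eta k ->
  hb eta c (g p) = hb xi (c / k) p :> Prop.
Proof. by move=> [k0 h]; rewrite /hb /mkset h ltr_pdivlMr // mulrC. Qed.

Lemma bdmap_image g f xi eta k c : cancel f g -> cancel g f ->
  bdmap g xi eta k -> g @` hb xi c = hb eta (k * c).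
Proof.
move=> fK gK bg; have k0 := bg.1; apply/seteqP; split=> [_ [q hq <-]|p hp].
  by rewrite (bdmap_hb _ _ bg) [k * c]mulrC mulfK ?gt_eqF.
exists (f p) => //; move: hp; rewrite -{1}(fK p) (bdmap_hb _ _ bg).
by rewrite [k * c]mulrC mulfK ?gt_eqF.
Qed.

Lemma fixes_bdP g xi : Defs.isometry g -> fixes_bd g xi <-> exists k, bdmap g xi xi k.
Proof.
move=> ig; have [[f gK fK] _] := ig; split=> [fix_xi|[k bg] B].
  have [eta [k bg]] := isometry_boundary xi ig.
  have : is_horoball_at xi (hb xi 1) by apply/is_horoball_atP; exists 1.
  move=> /fix_xi; rewrite (bdmap_image 1 fK gK bg) => /is_horoball_atP[c [c0 e]].
  have k0 : 0 < k * 1 by rewrite mulr1; case: bg.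
  by have [e1 _] := hb_inj k0 c0 e; exists k; rewrite -{2}e1.
move=> /is_horoball_atP[c [c0 ->]]; apply/is_horoball_atP; exists (k * c).
by rewrite mulr_gt0 //; [split=> //; exact: bdmap_image|case: bg].
Qed.

Lemma image_horoball g H : Defs.isometry g -> is_horoball H -> is_horoball (g @` H).
Proof.
move=> ig [xi /is_horoball_atP[c [c0 ->]]]; have [[f gK fK] _] := ig.
have [eta [k bg]] := isometry_boundary xi ig.
by rewrite (bdmap_image c fK gK bg); apply: hb_is_horoball; rewrite mulr_gt0 //; case: bg.
Qed.

Context (G : set (pt -> pt)) (HG : isom_group G).

Let isoG g : G g -> Defs.isometry g. Proof. by case: HG => _; apply. Qed.

Let compG g h : G g -> G h -> G (g \o h).
Proof. by case: HG => -[_ [+ _]] _; apply. Qed.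

Lemma isom_group_inv g : G g -> exists f, [/\ G f, cancel f g & cancel g f].
Proof.
case: HG => -[_ [_ +]] _ => /[apply] -[f [Gf [fg gf]]]; exists f; split=> // p.
  by rewrite -[LHS]/((g \o f) p) gf.
by rewrite -[LHS]/((f \o g) p) fg.
Qed.

(** Precise invariance of the horoball under the stabilizer of xi in G. *)
Definition noncross xi c := forall g p, G g -> hb xi c p -> hb xi c (g p) ->
  exists k, bdmap g xi xi k.

Lemma cusp_regionP xi B : cusp_region G xi B ->
  exists c, [/\ 0 < c, B = hb xi c & noncross xi c].
Proof.
move=> [_ [/is_horoball_atP[c [c0 ->]] nc]]; exists c; split=> // g p Gg hp hgp.
apply/(fixes_bdP xi (isoG Gg)); apply: contrapT => nf.
exact: nc Gg nf _ hp hgp.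
Qed.

(** For c <= c' both [g p] and [g' p] lie in the horoball of size c', so [g' \o g^-1] fixes xi and
    the two preimages of xi agree. *)
Lemma noncross_disjoint xi c c' eta eta' g g' k k' p : noncross xi c -> noncross xi c' ->
  G g -> G g' -> bdmap g eta xi k -> bdmap g' eta' xi k' ->
  hb xi c (g p) -> hb xi c' (g' p) -> eta = eta'.
Proof.
wlog cc : c c' eta eta' g g' k k' / c <= c'.
  move=> H nc nc' Gg Gg' b b' h h'; have [le|/ltW le] := leP c c'.
    exact: (H c c' eta eta' g g' k k').
  by symmetry; apply: (H c' c eta' eta g' g k' k).
move=> _ nc' Gg Gg' b b' h h'.
have [f [Gf fK gK]] := isom_group_inv Gg.
have [l bl] : exists l, bdmap (g' \o f) xi xi l.
  apply: (nc' _ (g p)); first exact: compG.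
    exact: lt_le_trans h cc.
  by rewrite /= gK.
have bf := bdmap_inv fK b.
have [[f' gK' fK'] _] := isoG Gg'.
have := bdmap_comp bl (bdmap_inv fK' b').
have -> : f' \o (g' \o f) = f by apply/funext => q; rewrite /= gK'.
move=> bf'; have := bdmap_inv gK bf; have := bdmap_inv gK bf'.
move=> h1 h2; exact: bdmap_inj h2 h1.
Qed.

Definition orbit_fam xi c eta d := exists g k, [/\ G g, bdmap g eta xi k & d = c / k].

Lemma gpreE xi c : gpre G (hb xi c) = fam_union (orbit_fam xi c).
Proof.
apply/seteqP; split=> p.
  move=> [g [Gg hg]]; have [f [Gf fK gK]] := isom_group_inv Gg.
  have [eta [k bf]] := isometry_boundary xi (isoG Gf).
  have bg := bdmap_inv gK bf.
  exists eta, (c / k^-1); split; first by exists g, k^-1.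
  by rewrite -(bdmap_hb _ _ bg).
move=> [eta [d [[g [k [Gg bg ->]]] hp]]].
by exists g; split=> //; rewrite (bdmap_hb _ _ bg).
Qed.

Lemma orbit_fam_disj xi c : noncross xi c -> forall eta eta' d d' p,
  orbit_fam xi c eta d -> orbit_fam xi c eta' d' ->
  hb eta d p -> hb eta' d' p -> eta = eta'.
Proof.
move=> nc eta eta' d d' p [g [k [Gg bg ->]]] [g' [k' [Gg' bg' ->]]].
rewrite -(bdmap_hb _ _ bg) -(bdmap_hb _ _ bg').
exact: (noncross_disjoint nc nc Gg Gg' bg bg').
Qed.

(** Comparable cusp regions have G-equivalent centers: [fam_base] is applied to the lifts of the
    larger one. *)
Lemma gpre_sub_base xi xi' c c' : 0 < c -> 0 < c' -> noncross xi' c' ->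
  (exists o, ~ gpre G (hb xi' c') o) ->
  gpre G (hb xi c) `<=` gpre G (hb xi' c') ->
  exists g k, G g /\ bdmap g xi xi' k.
Proof.
move=> c0 c0' nc' no sub.
have : exists d, orbit_fam xi' c' xi d.
  apply: (fam_base (orbit_fam_disj nc') _ c0); first by rewrite -gpreE.
  rewrite -gpreE => p hp; apply: sub; exists id; split=> //.
  by case: HG => -[].
by move=> [d [g [k [Gg bg _]]]]; exists g, k.
Qed.

Section MaximalCusp.
Context (xi0 : bpt) (B0 : set pt) (HB0 : cusp_region G xi0 B0).
Let S := max_cusp_lift G xi0 B0.

(** Comparable cusp regions may be presented at different parabolic points; here all are transported
    to [xi0], so that every lift is a translate of a horoball at [xi0]. *)
Definition cusp_fam eta d := exists g k c, [/\ G g /\ bdmap g eta xi0 k, 0 < c,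
  noncross xi0 c, hb xi0 c `<=` S & d = c / k].

Lemma max_cusp_lift_inv g p : G g -> S p -> S (g p).
Proof.
move=> Gg [xi [B [cB [comp [h [Gh hp]]]]]]; exists xi, B; split=> //; split=> //.
have [f [Gf fK gK]] := isom_group_inv Gg.
by exists (h \o f); split; [exact: compG|rewrite /= gK].
Qed.

(** By [gpre_sub_base] an element h of G carries the center of each comparable region to [xi0];
    conjugation by h preserves precise invariance. *)
Lemma max_cusp_liftE : (exists o, ~ S o) -> S = fam_union cusp_fam.
Proof.
move=> [z no]; apply/seteqP; split=> p; last first.
  move=> [eta [d [[g [k [c [[Gg bg] c0 nc sub ->]]]] hp]]].
  rewrite -(bdmap_hb _ _ bg) in hp.
  have [f [Gf fK gK]] := isom_group_inv Gg.
  by rewrite -(gK p); apply: max_cusp_lift_inv => //; apply: sub.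
move=> Sp; have := Sp => -[xi [B [cB [comp hp]]]].
have BS : gpre G B `<=` S by move=> q hq; exists xi, B.
have B0S : gpre G B0 `<=` S by move=> q hq; exists xi0, B0; split=> //; split=> //; left.
have [c [c0 eB nc]] := cusp_regionP cB.
have [c' [c0' eB0 nc']] := cusp_regionP HB0.
have [h [l [Gh bh]]] : exists g k, G g /\ bdmap g xi xi0 k.
  case: comp; rewrite eB eB0 => sub.
    by apply: gpre_sub_base sub => //; exists z => /=; rewrite -eB0 => /B0S.
  have [|f [k [Gf bf]]] := gpre_sub_base c0' c0 nc _ sub.
    by exists z; rewrite -eB => /BS.
  have [g [Gg gK fK]] := isom_group_inv Gf.
  by exists g, k^-1; split=> //; apply: bdmap_inv gK bf.
have [h' [Gh' hK hK']] := isom_group_inv Gh.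
have l0 := bh.1.
have hbl q : hb xi0 (l * c) q = hb xi c (h' q) :> Prop.
  by rewrite -{1}(hK q) (bdmap_hb _ _ bh) [l * c]mulrC mulfK ?gt_eqF.
have [g [Gg hg]] := hp.
pose hg' := h \o g; have Ghg : G hg' by apply: compG.
have [f [Gf fK gK]] := isom_group_inv Ghg.
have [eta [k bf]] := isometry_boundary xi0 (isoG Gf).
have bg := bdmap_inv gK bf.
exists eta, (l * c / k^-1); split; last first.
  by rewrite -(bdmap_hb _ _ bg) hbl /hg' /= hK' -eB.
exists hg', k^-1, (l * c); split=> //; first exact: mulr_gt0.
- move=> g' q Gg'; rewrite !hbl => h1 h2.
  have Gc : G (h' \o (g' \o h)) by apply: compG => //; exact: compG.
  have [|l1 bz] := nc _ (h' q) Gc h1; first by rewrite /= hK.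
  have := bdmap_comp (bdmap_inv hK bh) (bdmap_comp bz bh).
  have -> : (h \o (h' \o (g' \o h))) \o h' = g' by apply/funext => w; rewrite /= !hK.
  by move=> bb; eexists; exact: bb.
- move=> q; rewrite hbl => hq; apply: BS; exists h'; split=> //.
  by rewrite eB.
Qed.

Lemma cusp_fam_gt0 eta d : cusp_fam eta d -> 0 < d.
Proof. by move=> [g [k [c [[_ [k0 _]] c0 _ _ ->]]]]; rewrite divr_gt0. Qed.

Lemma cusp_fam_disj eta eta' d d' p : cusp_fam eta d -> cusp_fam eta' d' ->
  hb eta d p -> hb eta' d' p -> eta = eta'.
Proof.
move=> [g [k [c [[Gg bg] c0 nc sub ->]]]] [g' [k' [c' [[Gg' bg'] c0' nc' sub' ->]]]].
rewrite -(bdmap_hb _ _ bg) -(bdmap_hb _ _ bg').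
exact: (noncross_disjoint nc nc' Gg Gg' bg bg').
Qed.

Lemma max_horoball_image g H : G g -> horoball_of S H -> horoball_of S (g @` H).
Proof.
move=> Gg [hH [sub maxH]]; have [f [Gf fK gK]] := isom_group_inv Gg.
split; first exact: image_horoball (isoG Gg) hH.
split=> [_ [q hq <-]|H' hH' sub' HS]; first by apply: max_cusp_lift_inv => //; exact: sub.
have e : f @` H' = H.
  apply: maxH; first exact: image_horoball (isoG Gf) hH'.
    by move=> q hq; exists (g q); [apply: sub'; exists q|rewrite gK].
  by move=> _ [q hq <-]; apply: max_cusp_lift_inv => //; exact: HS.
apply/seteqP; split=> [q hq|_ [q + <-]].
  by exists (f q) => //; rewrite -e; exists q.
by rewrite -e => -[q' hq' <-]; rewrite fK.
Qed.

Lemma max_horoball_eq H1 H2 p :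
  horoball_of S H1 -> horoball_of S H2 -> H1 p -> H2 p -> H1 = H2.
Proof.
move=> m1; have [z no] : exists o, ~ S o.
  apply: contrapT => no.
  have all o : S o by apply: contrapT => h; apply: no; exists o.
  case: m1 => [[zeta /is_horoball_atP[e [e0 ->]]] [sub maxH]].
  have e2 : 0 < 2 * e by lra.
  have : hb zeta (2 * e) = hb zeta e.
    apply: maxH => //; first exact: hb_is_horoball.
    by move=> q; rewrite /hb /mkset; lra.
  by move=> /(hb_inj e2 e0)[_]; lra.
move: m1; rewrite max_cusp_liftE; last by exists z.
move=> m1 m2; apply: (maximal_horoball_eq cusp_fam_gt0 cusp_fam_disj m1 m2).
Qed.

Lemma tangency_chd p g : tangency_point G xi0 B0 p -> G g -> g p <> p ->
  3 / 2 <= chd p (g p).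
Proof.
move=> [H1 [H2 [ne [m1 [m2 [p1 p2]]]]]] Gg gp.
have [[f gK fK] _] := isoG Gg.
have [xi1 /is_horoball_atP[c1 [c10 e1]]] := m1.1.
have [xi2 /is_horoball_atP[c2 [c20 e2]]] := m2.1.
have [eta1 [k1 b1]] := isometry_boundary xi1 (isoG Gg).
have [eta2 [k2 b2]] := isometry_boundary xi2 (isoG Gg).
have n1 := max_horoball_image Gg m1; have n2 := max_horoball_image Gg m2.
rewrite e1 (bdmap_image c1 fK gK b1) in n1.
rewrite e2 (bdmap_image c2 fK gK b2) in n2.
have k10 := b1.1; have k20 := b2.1.
have d10 : 0 < k1 * c1 by rewrite mulr_gt0.
have d20 : 0 < k2 * c2 by rewrite mulr_gt0.
rewrite e1 in m1 p1 ne; rewrite e2 in m2 p2 ne.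
have nne : hb eta1 (k1 * c1) <> hb eta2 (k2 * c2).
  rewrite -(bdmap_image c1 fK gK b1) -(bdmap_image c2 fK gK b2) => e.
  apply: ne; apply/seteqP; split=> q hq.
    have : (g @` hb xi1 c1) (g q) by exists q.
    by rewrite e => -[q' hq' /(can_inj gK) <-].
  have : (g @` hb xi2 c2) (g q) by exists q.
  by rewrite -e => -[q' hq' /(can_inj gK) <-].
have np1 : ev (bvec eta1) (g p) <= k1 * c1.
  by rewrite b1.2 ler_pM2l //; apply: hclosure_hb.
have np2 : ev (bvec eta2) (g p) <= k2 * c2.
  by rewrite b2.2 ler_pM2l //; apply: hclosure_hb.
have pp1 := hclosure_hb p1; have pp2 := hclosure_hb p2.
have far xi eta c d : 0 < c -> 0 < d -> horoball_of S (hb xi c) -> horoball_of S (hb eta d) ->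
    hb xi c <> hb eta d -> 2 <= lform (svec c^-1 (bvec xi)) (svec d^-1 (bvec eta)).
  move=> c0 d0 mc md ned; rewrite lform_svecl lform_svecr mulrA -invfM.
  rewrite ler_pdivlMl ?mulr_gt0 // [X in X <= _](_ : _ = 2 * d * c); last by ring.
  rewrite lformC; apply: hb_disjoint_form => // q h1 h2; apply: ned.
  exact: max_horoball_eq mc md h2 h1.
have null xi c : lform (svec c^-1 (bvec xi)) (svec c^-1 (bvec xi)) = 0.
  by rewrite lform_svecl lform_svecr lform_bvec_self !mulr0.
have val xi c q : 0 < c -> ev (bvec xi) q <= c -> 0 < ev (svec c^-1 (bvec xi)) q <= 1.
  move=> c0 h; rewrite ev_svec mulr_gt0 ?invr_gt0 ?ev_bvec_gt0 //=.
  by rewrite ler_pdivrMl // mulr1.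
have mid := tangency_midpoint (null xi1 c1) (null xi2 c2) (far _ _ _ _ c10 c20 m1 m2 ne)
  (val _ _ _ c10 pp1) (val _ _ _ c20 pp2).
have mid' := tangency_midpoint (null eta1 _) (null eta2 _) (far _ _ _ _ d10 d20 n1 n2 nne)
  (val _ _ _ d10 np1) (val _ _ _ d20 np2).
rewrite -ev_ptvec mid' !(lformC (ptvec p)) !lform_ptvec !mid.
have same : (forall w, ev w p = ev w (g p)) -> False.
  move=> h; apply: gp; symmetry; apply: chd_le1.
  by rewrite -ev_ptvec -h ev_ptvec chd_refl.
have {}mid w := mid w; have {}mid' w := mid' w.
have pair xi eta c d : 0 < c -> 0 < d -> horoball_of S (hb xi c) -> horoball_of S (hb eta d) ->
    (lform (svec c^-1 (bvec xi)) (svec d^-1 (bvec eta)) = 0 ->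
      hb xi c = hb eta d /\ svec c^-1 (bvec xi) = svec d^-1 (bvec eta)) /\
    (lform (svec c^-1 (bvec xi)) (svec d^-1 (bvec eta)) = 0 \/
    2 <= lform (svec c^-1 (bvec xi)) (svec d^-1 (bvec eta))).
  move=> c0 d0 mc md; have [e|ned] := pselect (hb xi c = hb eta d).
    by have [<- <-] := hb_inj c0 d0 e; rewrite null; split; [|left].
  by have h := far _ _ _ _ c0 d0 mc md ned; split; [move=> e; move: h; rewrite e leNgt ltr0n|right].
have [i1 o1] := pair _ _ _ _ d10 c10 n1 m1; have [i2 o2] := pair _ _ _ _ d10 c20 n1 m2.
have [i3 o3] := pair _ _ _ _ d20 c10 n2 m1; have [i4 o4] := pair _ _ _ _ d20 c20 n2 m2.
(* Two vanishing terms sharing a horoball would identify the two horoballs at p or the two at [g p].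
   Two vanishing terms without a common horoball mean that g permutes the pair at p, hence fixes its
   midpoint p. *)
apply: (mean4_ge o1 o2 o3 o4).
- by move=> /i1[a _] /i2[b _]; apply: ne; rewrite -a -b.
- by move=> /i1[a _] /i3[b _]; apply: nne; rewrite a b.
- by move=> /i1[_ a] /i4[_ b]; apply: same => w; rewrite mid mid' a b.
- by move=> /i2[_ a] /i3[_ b]; apply: same => w; rewrite mid mid' a b addrC.
- by move=> /i2[a _] /i4[b _]; apply: nne; rewrite a b.
- by move=> /i3[a _] /i4[b _]; apply: ne; rewrite -a -b.
Qed.

End MaximalCusp.

Lemma rinj_ge p : (forall g, G g -> g = id \/ 3 / 2 <= chd p (g p)) ->
  ((acosh (Num.sqrt 5 / 2 : R))%:E <= rinj G p)%E.
Proof.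
move=> h; apply: ereal_sup_ubound; exists (acosh (Num.sqrt 5 / 2)) => //.
split; first exact: acosh_sqrt5_gt0.
move=> q q' hq hq' g Gg gq; have [e|far] := h g Gg; first by rewrite -gq e.
have [_ gd] := isoG Gg.
have : hdist p (g p) < acosh (3 / 2).
  apply: le_lt_trans (hdist_triangle p q' (g p)) _.
  by rewrite -acosh_sqrt5_double ltrD // -gq gd hdistC.
by rewrite hdistE ltNge le_acosh ?far // ?chd_ge1 //; lra.
Qed.

Lemma rinj_le p g : G g -> (forall q, g q <> q) -> chd p (g p) <= 3 / 2 ->
  (rinj G p <= (acosh (Num.sqrt 5 / 2 : R))%:E)%E.
Proof.
move=> Gg free near; apply: ge_ereal_sup => _ [r [r0 hr] <-]; rewrite lee_fin leNgt.
apply/negP => lt; have [f [Gf fK gK]] := isom_group_inv Gg.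
have [_ gd] := isoG Gg.
(* The normalised w is the midpoint q of p and [f p], with f the inverse of g. Then [g q] is the
   midpoint of [g p] and p, so q and [g q] both lie at half the displacement from p. *)
pose w := ptvec p + ptvec (f p).
have c : chd p (f p) = chd p (g p).
  by rewrite chdC; apply: hdist_eq_chd; rewrite -gd fK.
have ww : lform w w = 2 + 2 * chd p (g p).
  rewrite /w !lformDl !lformDr !lform_ptvec !ev_ptvec !chd_refl (chdC (f p)) c; ring.
have c1 := chd_ge1 p (g p).
have w2 : 0 < w.2 by rewrite addr_gt0 // invr_gt0 mulr_gt0 // hy_gt0.
have W0 : 0 < lform w w by lra.
have [q hq] := timelike_point w2 W0.
have s0 : 0 < Num.sqrt (lform w w) by rewrite sqrtr_gt0; lra.
have ss : Num.sqrt (lform w w) ^+ 2 = lform w w by rewrite sqr_sqrtr //; lra.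
have wp : lform (ptvec p) w = lform w w / 2.
  by rewrite ww lformC lform_ptvec evDl !ev_ptvec chd_refl chdC c; field.
have wf : lform (ptvec (f p)) w = lform w w / 2.
  by rewrite ww lformC lform_ptvec evDl !ev_ptvec chd_refl c; field.
have h5 := @sqr_sqrt5 R; have h52 := @sqrt5_ge2 R.
have small : lform w w / 2 / Num.sqrt (lform w w) <= Num.sqrt 5 / 2.
  rewrite -{1}ss (_ : _ / _ = Num.sqrt (lform w w) / 2); last by field; rewrite gt_eqF.
  rewrite ler_pM2r ?invr_gt0 // ler_sqrt //; lra.
have dp : hdist p q < r.
  apply: le_lt_trans lt; rewrite le_hdist; last by lra.
  by rewrite -ev_ptvec hq wp.
have df : hdist p (g q) < r.
  apply: le_lt_trans lt; rewrite -{1}(fK p) gd le_hdist; last by lra.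
  by rewrite -ev_ptvec hq wf.
exact: (free q) (esym (hr _ _ dp df g Gg erefl)).
Qed.

Lemma tangency_rinj_ge xi0 B0 p : (forall g q, G g -> g q = q -> g = id) ->
  cusp_region G xi0 B0 -> tangency_point G xi0 B0 p ->
  ((acosh (Num.sqrt 5 / 2 : R))%:E <= rinj G p)%E.
Proof.
move=> free cB tp; apply: rinj_ge => g Gg.
have [/(free _ _ Gg) ->|ne] := pselect (g p = p); [by left|right].
exact: (tangency_chd cB tp).
Qed.

End Cusp.

(** * Discrete torsion-free groups act freely *)

Section Freeness.
Context {R : realType} {m : nat}.
Local Notation pt := (hpt R m).
Implicit Types (p q r : pt) (g : pt -> pt).

Lemma acosh_surj (x : R) : 0 < x -> exists c, 1 < c /\ acosh c = x.
Proof.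
move=> x0; pose E := expR x.
have E1 : 1 < E by rewrite /E expR_gt1.
have Ei : E * E^-1 = 1 by rewrite mulfV // gt_eqF //; lra.
have I1 : E^-1 < 1 by rewrite invf_lt1 //; lra.
have I0 : 0 < E^-1 by rewrite invr_gt0; lra.
exists ((E + E^-1) / 2); split; first by nra.
rewrite /acosh.
have -> : ((E + E^-1) / 2) ^+ 2 - 1 = ((E - E^-1) / 2) ^+ 2.
  move: (E^-1) Ei => I Ei; transitivity (((E + I) / 2) ^+ 2 - E * I); first by rewrite Ei.
  by field.
rewrite sqrtr_sqr ger0_norm; last by lra.
have -> : (E + E^-1) / 2 + (E - E^-1) / 2 = E by lra.
by rewrite expRK.
Qed.

Lemma chd_hy_le p q : hy q <= 2 * chd p q * hy p.
Proof.
have [t0 s0] := (hy_gt0 p, hy_gt0 q).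
have := null_ev_le2 (lform_bvec_self None) (ev_bvec_gt0 None p) (ev_bvec_gt0 None q).
by rewrite !ev_bvecN ler_pdivlMr // ler_pdivrMl // [hy p * _]mulrC.
Qed.

Lemma chd_hx_le p q (i : 'I_m) : `|hx q 0 i - hx p 0 i| <= 2 * chd p q * hy p.
Proof.
have [t0 s0] := (hy_gt0 p, hy_gt0 q); have h1 := chd_ge1 p q.
have h := chd_hy_le p q.
have : esqd p q = 2 * (chd p q - 1) * hy p * hy q.
  by rewrite /chd; field; rewrite !gt_eqF.
rewrite /esqd (bigD1 i) //=; set u := \sum_(_ < _ | _) _ => e.
have u0 : 0 <= u by rewrite sumr_ge0 // => j _; rewrite sqr_ge0.
have h2 := sqr_ge0 (hy p - hy q).
have : (hx q 0 i - hx p 0 i) ^+ 2 <= (2 * chd p q * hy p) ^+ 2.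
  rewrite -sqrrN opprB.
  have : 2 * (chd p q - 1) * hy p * hy q <= 2 * chd p q * hy p * (2 * chd p q * hy p).
    apply: ler_pM => //; first by rewrite !mulr_ge0 //; lra.
      exact: ltW.
    by rewrite ler_pM2r //; lra.
  rewrite expr2; lra.
rewrite -ler_sqrt ?sqr_ge0 // !sqrtr_sqr => h3; apply: le_trans h3 _.
by rewrite ger0_norm // !mulr_ge0 //; lra.
Qed.

Lemma truncn_eq_close (x y : R) : 0 <= x -> 0 <= y ->
  Num.truncn x = Num.truncn y -> `|x - y| < 1.
Proof.
move=> x0 y0 e; have := truncn_itv x0; have := truncn_itv y0; rewrite -e.
rewrite -natr1 => /andP[h1 h2] /andP[h3 h4].
by rewrite ltr_norml; apply/andP; split; lra.
Qed.

(** Total boundedness of a ball, as a finite colouring by the cells of a Euclidean grid; heights on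
    the ball are bounded away from 0, so Euclidean closeness controls [chd]. *)
Lemma hyperbolic_net p (C d : R) : 0 < d -> 1 <= C ->
  exists (T : finType) (code : pt -> T), forall q q',
    chd p q <= C -> chd p q' <= C -> code q = code q' -> hdist q q' < d.
Proof.
move=> d0 C1; have [c [c1 cd]] := acosh_surj d0.
have t0 := hy_gt0 p.
pose K := 2 * C * hy p; have K0 : 0 < K by rewrite !mulr_gt0 //; lra.
(* Each of the m+1 coordinates contributes at most e^2, and both heights are at least
   [hy p / (2 * C)]; hence [L * e ^+ 2] bounds [chd - 1] on a cell. *)
pose L := m.+1%:R * (2 * C ^+ 2 / hy p ^+ 2).
have C0 : 0 < C by lra.
have L0 : 0 < L.
  rewrite /L mulr_gt0 ?ltr0n // divr_gt0 ?(exprn_gt0 2 t0) //.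
  by rewrite mulr_gt0 // (exprn_gt0 2 C0).
pose e := Num.min 1 ((c - 1) / (2 * L)).
have cc : 0 < c - 1 by lra.
have L2 : 0 < 2 * L by rewrite mulr_gt0.
have e0 : 0 < e by rewrite lt_min ltr01 divr_gt0.
have e1 : e <= 1 by rewrite ge_min lexx.
have e2 : e <= (c - 1) / (2 * L) by rewrite ge_min lexx orbT.
have Le : L * e ^+ 2 < c - 1.
  have : L * e ^+ 2 <= L * e by rewrite ler_pM2l // expr2 ler_piMr // ltW.
  have : L * e <= (c - 1) / 2.
    by move: e2; rewrite ler_pdivlMr // => h; lra.
  lra.
pose N := Num.truncn (2 * K / e).
pose fx (i : 'I_m) q := Num.truncn ((hx q 0 i - hx p 0 i + K) / e).
pose fy q := Num.truncn (hy q / e).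
exists ({ffun 'I_m -> 'I_N.+1} * 'I_N.+1)%type.
exists (fun q => ([ffun i => inord (fx i q)], inord (fy q))) => q q' hq hq'.
have bx r i : chd p r <= C -> 0 <= hx r 0 i - hx p 0 i + K <= 2 * K.
  move=> hr; have := chd_hx_le p r i; rewrite ler_norml => /andP[h1 h2].
  have : 2 * chd p r * hy p <= K by rewrite ler_pM2r //; lra.
  by move=> h3; apply/andP; split; lra.
have by_ r : chd p r <= C -> hy r <= K /\ hy p / (2 * C) <= hy r.
  move=> hr; split.
    by apply: le_trans (chd_hy_le p r) _; rewrite ler_pM2r //; lra.
  rewrite ler_pdivrMr; last by lra.
  rewrite mulrC; apply: le_trans (chd_hy_le r p) _; rewrite chdC ler_pM2r ?hy_gt0 //; lra.
have le_N (x : R) : 0 <= x <= 2 * K -> (Num.truncn (x / e) < N.+1)%N.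
  move=> /andP[x0 xK]; rewrite ltnS; apply: le_truncn.
  by rewrite ler_pM2r ?invr_gt0.
case=> /ffunP hfx hfy.
have ex i : (hx q 0 i - hx q' 0 i) ^+ 2 <= e ^+ 2.
  have := congr1 (@nat_of_ord N.+1) (hfx i); rewrite !ffunE !inordK ?le_N ?bx // => h.
  have := truncn_eq_close _ _ h; rewrite -!mulrBl normrM (gtr0_norm (_ : 0 < e^-1)) ?invr_gt0 //.
  have /andP[b1 _] := bx _ i hq; have /andP[b2 _] := bx _ i hq'.
  rewrite ltr_pdivrMr // mul1r => /(_ (divr_ge0 b1 (ltW e0)) (divr_ge0 b2 (ltW e0))).
  rewrite (_ : _ + K - _ = hx q 0 i - hx q' 0 i); last by ring.
  move=> h'; rewrite -real_normK ?num_real // lerXn2r ?nnegrE ?normr_ge0 //; exact: ltW.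
have ey : (hy q - hy q') ^+ 2 <= e ^+ 2.
  have hyb r : chd p r <= C -> 0 <= hy r <= 2 * K.
    by move=> /by_[h1 _]; have := hy_gt0 r => h2; apply/andP; split; lra.
  have := congr1 (@nat_of_ord N.+1) hfy; rewrite !inordK ?le_N ?hyb // => h.
  have := truncn_eq_close _ _ h; rewrite -!mulrBl normrM (gtr0_norm (_ : 0 < e^-1)) ?invr_gt0 //.
  rewrite ltr_pdivrMr // mul1r => /(_ (divr_ge0 (ltW (hy_gt0 q)) (ltW e0)) (divr_ge0 (ltW (hy_gt0 q')) (ltW e0))).
  move=> h'; rewrite -real_normK ?num_real // lerXn2r ?nnegrE ?normr_ge0 //; exact: ltW.
have es : esqd q q' <= m.+1%:R * e ^+ 2.
  rewrite -natr1 mulrDl mul1r lerD //.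
  apply: le_trans (ler_sum _ (fun i _ => ex i)) _.
  by rewrite sumr_const card_ord mulr_natl.
rewrite -cd hdistE lt_acosh ?chd_ge1 //; last exact: ltW.
rewrite /chd; suff : esqd q q' / (2 * hy q * hy q') <= L * e ^+ 2 by lra.
have [_ y1] := by_ _ hq; have [_ y2] := by_ _ hq'.
have y0 : 0 < hy p / (2 * C) by rewrite divr_gt0 //; lra.
have yy : (hy p / (2 * C)) ^+ 2 <= hy q * hy q' by rewrite expr2 ler_pM // ltW.
have [q0 q0'] := (hy_gt0 q, hy_gt0 q').
rewrite ler_pdivrMr ?mulr_gt0 //; apply: le_trans es _.
have -> : L * e ^+ 2 * (2 * hy q * hy q') =
  m.+1%:R * e ^+ 2 * (hy q * hy q' / (hy p / (2 * C)) ^+ 2).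
  have cn : C != 0 by rewrite gt_eqF.
  have tn := hy_neq0 p; rewrite /L; move: (m.+1%:R) (e ^+ 2) (hy q) (hy q') (hy p) tn.
  by move=> M E x y z tn; field; rewrite ?cn ?tn.
rewrite ler_peMr //; first by rewrite mulr_ge0 ?sqr_ge0.
by rewrite ler_pdivlMr ?exprn_gt0 // mul1r.
Qed.

Lemma pigeonhole_nat (T : finType) (F : nat -> T) :
  exists j k, (j < k)%N /\ F j = F k.
Proof.
pose f (i : 'I_#|T|.+1) := F i.
have : ~~ injectiveb f.
  apply/negP => /injectiveP inj; have := leq_card f inj.
  by rewrite card_ord ltnn.
move=> /injectivePn[x [y ne e]].
have [lt|lt|/val_inj e'] := ltngtP (x : nat) y; last by rewrite e' eqxx in ne.
  by exists x, y.
by exists y, x.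
Qed.

(* The powers of an element fixing p stay in the compact stabilizer of p, so
   two of them are uniformly close on any ball. *)
Lemma discrete_torsion_free_free (G : set (pt -> pt)) : isom_group G ->
  discrete_group G -> torsion_free G ->
  forall g p, G g -> g p = p -> g = id.
Proof.
move=> HG [x0 [r [eps [eps0 disc]]]] tf g p Gg gp.
have [[G1 [Gcomp _]] Gisom] := HG.
have Giter k : G (iter k g).
  by elim: k => [//|k IH]; exact: (Gcomp _ _ Gg IH).
have iterp k : iter k g p = p by elim: k => [//|k IH]; rewrite iterS IH.
have isoiter k q q' : hdist (iter k g q) (iter k g q') = hdist q q'.
  by have [_ ->] := Gisom _ (Giter k).
(* A ball about p, hence preserved by g, that contains the ball of radius r about [x0]; r may be
   negative, and the summand 1 keeps the radius positive. *)
pose r2 := hdist p x0 + `|r| + 1.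
have r20 : 0 < r2 by rewrite !ltr_wpDl // addr_ge0 ?hdist_ge0.
have [C [C1 hC]] := acosh_surj r20.
have inball q : hdist p q <= r2 -> chd p q <= C by rewrite -hC le_hdist // ltW.
have eps3 : 0 < eps / 3 by rewrite divr_gt0.
have [T [code hcode]] := hyperbolic_net p eps3 (ltW C1).
(* One representative in the ball for each colour, p by default for colours that do not occur there.
   [F k] records the colours of their images under the k-th power of g, and finitely many such
   records exist. *)
have /choice[rep hrep] : forall c : T, exists z, hdist p z <= r2 /\
    forall y, hdist p y <= r2 -> code y = c -> code z = c.
  move=> c; have [[y [hy1 hy2]]|no] := pselect (exists y, hdist p y <= r2 /\ code y = c).
    by exists y.
  exists p; rewrite hdist_refl; split; first exact: ltW.
  by move=> y h1 h2; exfalso; apply: no; exists y.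
pose F k := [ffun c => code (iter k g (rep c))].
have [j [k [jk Fjk]]] := pigeonhole_nat F.
apply: (tf _ Gg (k - j)%N); first by rewrite subn_gt0.
apply: disc (Giter _) _ => y hy0.
have py : hdist p y <= r2.
  apply: le_trans (hdist_triangle p x0 y) _; rewrite /r2.
  have := ler_norm r; lra.
have [prep crep'] := hrep (code y); have crep := crep' y py erefl.
have pit l z : hdist p z <= r2 -> hdist p (iter l g z) <= r2.
  by rewrite -{2}(iterp l) isoiter.
have d1 : hdist y (rep (code y)) < eps / 3 by apply: hcode; rewrite ?crep // inball.
have d2 : hdist (iter j g (rep (code y))) (iter k g (rep (code y))) < eps / 3.
  apply: hcode; [exact/inball/pit|exact/inball/pit|].
  by move/ffunP/(_ (code y)): Fjk; rewrite !ffunE.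
rewrite hdistC -(isoiter j) -iterD subnKC; last exact: ltnW.
apply: le_lt_trans (hdist_triangle _ (iter j g (rep (code y))) _) _.
apply: le_lt_trans (lerD (lexx _) (hdist_triangle _ (iter k g (rep (code y))) _)) _.
rewrite !isoiter (hdistC _ y); lra.
Qed.

End Freeness.

(** * The integral action on null vectors and the orientation modulo 4 *)

Section IntegerRows.

(* A row u stands for the combination of the horofunctions of the four vertices
   of the tetrahedron; zU, zV, zU', zV' are the precompositions with the two
   generators of the Gieseking group and their inverses. *)
Definition zrow := (int * int * int * int)%type.

Definition ze (k : nat) : zrow :=
  ((k == 0%N)%:Z, (k == 1%N)%:Z, (k == 2)%:Z, (k == 3)%:Z).

Definition zsum (u : zrow) : int := let: (a, b, c, d) := u in a + b + c + d.

(** Half of the Lorentz form [lform]: the unit horoballs at the four vertices are pairwise tangent,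
    so distinct vertices pair to 2 there and to 1 here. *)
Definition zform (u v : zrow) : int :=
  let: (a, b, c, d) := u in let: (a', b', c', d') := v in
  zsum u * zsum v - (a * a' + b * b' + c * c' + d * d').

Definition zU (u : zrow) : zrow :=
  let: (a, b, c, d) := u in (a + b, b + c, b + d, - b).
Definition zV (u : zrow) : zrow :=
  let: (a, b, c, d) := u in (a + b, a + c, - a, a + d).
Definition zU' (u : zrow) : zrow :=
  let: (a, b, c, d) := u in (a + d, - d, b + d, c + d).
Definition zV' (u : zrow) : zrow :=
  let: (a, b, c, d) := u in (- c, a + c, b + c, c + d).

Definition row4 := (nat * nat * nat * nat)%type.

(** The reduction makes the orbit of the oriented edges finite, hence computable. *)
Definition mod4 (x : int) : nat := `|(x %% 4)%Z|%N.
Definition zmod4 (u : zrow) : row4 :=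
  let: (a, b, c, d) := u in (mod4 a, mod4 b, mod4 c, mod4 d).

Local Notation add4 a b := ((a + b) %% 4)%N.
Local Notation opp4 a := ((3 * a) %% 4)%N.

Definition nU (u : row4) : row4 :=
  let: (a, b, c, d) := u in (add4 a b, add4 b c, add4 b d, opp4 b).
Definition nV (u : row4) : row4 :=
  let: (a, b, c, d) := u in (add4 a b, add4 a c, opp4 a, add4 a d).
Definition nU' (u : row4) : row4 :=
  let: (a, b, c, d) := u in (add4 a d, opp4 d, add4 b d, add4 c d).
Definition nV' (u : row4) : row4 :=
  let: (a, b, c, d) := u in (opp4 c, add4 a c, add4 b c, add4 c d).

Lemma mod4D x y : mod4 (x + y) = add4 (mod4 x) (mod4 y).
Proof. rewrite /mod4; lia. Qed.

Lemma mod4N x : mod4 (- x) = opp4 (mod4 x).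
Proof. rewrite /mod4; lia. Qed.

Lemma zmod4U u : zmod4 (zU u) = nU (zmod4 u).
Proof. by case: u => [[[a b] c] d]; rewrite /= !mod4D !mod4N. Qed.
Lemma zmod4V u : zmod4 (zV u) = nV (zmod4 u).
Proof. by case: u => [[[a b] c] d]; rewrite /= !mod4D !mod4N. Qed.
Lemma zmod4U' u : zmod4 (zU' u) = nU' (zmod4 u).
Proof. by case: u => [[[a b] c] d]; rewrite /= !mod4D !mod4N. Qed.
Lemma zmod4V' u : zmod4 (zV' u) = nV' (zmod4 u).
Proof. by case: u => [[[a b] c] d]; rewrite /= !mod4D !mod4N. Qed.

Definition pair_map (f : row4 -> row4) (x : row4 * row4) := (f x.1, f x.2).

(** Each unit of fuel expands one pair of the front. That the fuel suffices is certified afterwards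
    by [oriented4_closed]. *)
Fixpoint orbit4 (n : nat) (front seen : seq (row4 * row4)) : seq (row4 * row4) :=
  if n is n'.+1 then
    if front is x :: fr then
      let new := [seq y <- [:: pair_map nU x; pair_map nV x] | y \notin seen] in
      orbit4 n' (fr ++ new) (new ++ seen)
    else seen
  else seen.

Definition edges4 : seq (row4 * row4) :=
  [seq (zmod4 (ze x.1), zmod4 (ze x.2)) |
     x <- [:: (0, 1); (0, 2); (0, 3); (1, 2); (1, 3); (2, 3)]%N].

(* The orbit modulo 4 of the edges of the tetrahedron oriented by increasing
   vertices; it has 320 elements and meets no reversed edge. *)
Definition oriented4 : seq (row4 * row4) := orbit4 400 edges4 edges4.

Definition oriented (u v : zrow) : bool := (zmod4 u, zmod4 v) \in oriented4.

Lemma oriented4_closed :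
  all (fun x => [&& pair_map nU x \in oriented4, pair_map nV x \in oriented4,
    pair_map nU' x \in oriented4 & pair_map nV' x \in oriented4]) oriented4.
Proof. by vm_compute. Qed.

Lemma oriented_gen u v : oriented u v ->
  [/\ oriented (zU u) (zU v), oriented (zV u) (zV v),
      oriented (zU' u) (zU' v) & oriented (zV' u) (zV' v)].
Proof.
rewrite /oriented !zmod4U !zmod4V !zmod4U' !zmod4V'.
move: oriented4 oriented4_closed => L /allP closed /closed.
by case/and4P => h1 h2 h3 h4; split.
Qed.

Lemma oriented_ze i j : (i < 4)%N -> (j < 4)%N -> oriented (ze i) (ze j) = (i < j)%N.
Proof.
have : all (fun i => all (fun j => oriented (ze i) (ze j) == (i < j)%N) (iota 0 4)) (iota 0 4).
  by vm_compute.
move=> /allP h hi hj; have /allP h' := h i ltac:(by rewrite mem_iota).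
by have /eqP := h' j ltac:(by rewrite mem_iota).
Qed.

(** Sum 1 and form 0 leave an integer vector of Euclidean norm 1. Thus null rows taking at the
    center the same value as the vertices are vertices. *)
Lemma zform_unit u : zsum u = 1 -> zform u u = 0 -> exists2 k, (k < 4)%N & u = ze k.
Proof.
case: u => [[[a b] c] d] /= h; rewrite h => h2.
have h3 : a * a + b * b + c * c + d * d = 1 by lia.
have [ha hb hc hd] : [/\ -1 <= a <= 1, -1 <= b <= 1, -1 <= c <= 1 & -1 <= d <= 1].
  split; nia.
have : (a = 1 /\ b = 0 /\ c = 0 /\ d = 0) \/ (a = 0 /\ b = 1 /\ c = 0 /\ d = 0) \/
  (a = 0 /\ b = 0 /\ c = 1 /\ d = 0) \/ (a = 0 /\ b = 0 /\ c = 0 /\ d = 1) by nia.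
case=> [|[|[|]]] => -[-> [-> [-> ->]]].
- by exists 0%N.
- by exists 1%N.
- by exists 2%N.
- by exists 3%N.
Qed.

(** The two linear conditions, pairing 1 with the ends of an edge, cut the null cone in an ellipse,
    which has finitely many integer points. *)
Lemma null_row_bound (a b c d : int) : b + c + d = 1 -> a + c + d = 1 ->
  (a + b + c + d) * (a + b + c + d) - (a * a + b * b + c * c + d * d) = 0 ->
  [/\ -1 <= a <= 2, -1 <= b <= 2, -1 <= c <= 2 & -1 <= d <= 2].
Proof.
move=> h1 h2 h3; have eb : b = a by lia.
have ed : d = 1 - a - c by lia.
subst b d.
have sq : 0 <= (c - (1 - a - c)) * (c - (1 - a - c)) by rewrite -expr2 sqr_ge0.
have ha : 0 <= a <= 2 by nia.
have hc : -1 <= c <= 1 by nia.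
have hd : -1 <= 1 - a - c <= 1 by nia.
by split; lia.
Qed.

Definition box : seq int := [:: -1; 0; 1; 2].
Definition boxes : seq zrow :=
  [seq (x.1.1, x.1.2, x.2.1, x.2.2) | x <- allpairs pair (allpairs pair box box) (allpairs pair box box)].

(* The six vertices of the tetrahedra around the edge ij. *)
Definition link (i j : nat) : seq zrow := [seq u <- boxes |
  [&& zform u u == 0, zform u (ze i) == 1 & zform u (ze j) == 1]].

Definition same_orientation (i k : nat) (u : zrow) : bool :=
  if (i < k)%N then oriented (ze i) u else oriented u (ze i).

(** Around the edge ij, only k and l themselves are oriented towards i, j and each other as k and l
    are. *)
Definition link_check (x : nat * nat * nat * nat) : bool :=
  let: (i, j, k, l) := x in
  all (fun u => [&& same_orientation i k u & same_orientation j k u] ==>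
    all (fun v => [&& same_orientation i l v, same_orientation j l v & oriented u v] ==>
      ((u == ze k) && (v == ze l))) (link i j)) (link i j).

Definition splittings : seq (nat * nat * nat * nat) :=
  [:: (0, 1, 2, 3); (0, 2, 1, 3); (0, 3, 1, 2); (1, 2, 0, 3); (1, 3, 0, 2); (2, 3, 0, 1)]%N.

Lemma link_checkP : all link_check splittings.
Proof. by vm_compute. Qed.

Lemma mem_boxes (a b c d : int) : -1 <= a <= 2 -> -1 <= b <= 2 -> -1 <= c <= 2 ->
  -1 <= d <= 2 -> (a, b, c, d) \in boxes.
Proof.
have inbox (x : int) : -1 <= x <= 2 -> x \in box.
  move=> h; have : x = -1 \/ x = 0 \/ x = 1 \/ x = 2 by lia.
  by case=> [->|[->|[->|->]]].
move=> /inbox ha /inbox hb /inbox hc /inbox hd.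
by apply/mapP; exists ((a, b), (c, d)) => //; apply: allpairs_f; apply: allpairs_f.
Qed.

Lemma mem_link i j u : (i < j < 4)%N ->
  zform u u = 0 -> zform u (ze i) = 1 -> zform u (ze j) = 1 -> u \in link i j.
Proof.
move=> ij h1 h2 h3; rewrite mem_filter h1 h2 h3 !eqxx /=.
case: u h1 h2 h3 => [[[a b] c] d] /=.
have : (i = 0 /\ j = 1 \/ i = 0 /\ j = 2 \/ i = 0 /\ j = 3 \/
        i = 1 /\ j = 2 \/ i = 1 /\ j = 3 \/ i = 2 /\ j = 3)%N by lia.
by case=> [|[|[|[|[|]]]]] => -[-> ->] /= h1 h2 h3; apply: mem_boxes;
 first [have [] := @null_row_bound a b c d ltac:(lia) ltac:(lia) ltac:(lia)
       |have [] := @null_row_bound a c b d ltac:(lia) ltac:(lia) ltac:(lia)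
       |have [] := @null_row_bound a d b c ltac:(lia) ltac:(lia) ltac:(lia)
       |have [] := @null_row_bound b c a d ltac:(lia) ltac:(lia) ltac:(lia)
       |have [] := @null_row_bound b d a c ltac:(lia) ltac:(lia) ltac:(lia)
       |have [] := @null_row_bound c d a b ltac:(lia) ltac:(lia) ltac:(lia)].
Qed.

#[local] Opaque oriented4 link.

(** Excludes a motion around an edge with both ends fixed: the images of the other two vertices lie
    in the link of the edge, where [link_checkP] leaves one choice. *)
Lemma rows_of_edge (r : nat -> zrow) i j :
  (forall k l, (k < 4)%N -> (l < 4)%N -> zform (r k) (r l) = zform (ze k) (ze l)) ->
  (forall k l, (k < l < 4)%N -> oriented (r k) (r l)) ->
  (i < j < 4)%N -> r i = ze i -> r j = ze j ->
  forall k, (k < 4)%N -> r k = ze k.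
Proof.
move=> hform hor ij ri rj.
have key k l : (i, j, k, l) \in splittings -> (k < l < 4)%N ->
    i != k -> j != k -> i != l -> j != l -> r k = ze k /\ r l = ze l.
  move=> spl kl ik jk il jl; have /allP/(_ _ spl)/= /allP chk := link_checkP.
  have lk h : (h < 4)%N -> i != h -> j != h -> zform (ze h) (ze i) = 1 ->
      zform (ze h) (ze j) = 1 -> zform (ze h) (ze h) = 0 -> r h \in link i j.
    by move=> h4 _ _ e1 e2 e3; apply: mem_link; rewrite // -?ri -?rj hform ?e1 ?e2 ?e3; lia.
  have so h g : (g < 4)%N -> (h < 4)%N -> g != h -> r g = ze g -> same_orientation g h (r h).
    move=> g4 h4 gh rg; rewrite /same_orientation; case: ltnP => hg.
      by rewrite -rg; apply: hor; rewrite hg.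
    by rewrite -rg; apply: hor; lia.
  have zf (x y : nat) : (x < 4)%N -> (y < 4)%N -> zform (ze x) (ze y) = (x != y)%:Z.
    by move: x y => [|[|[|[|x]]]] // [|[|[|[|y]]]].
  have [k4 l4 i4 j4] : [/\ (k < 4)%N, (l < 4)%N, (i < 4)%N & (j < 4)%N] by split; lia.
  have /chk/implyP H : r k \in link i j.
    by apply: lk; rewrite ?zf ?eqxx // eq_sym ?ik ?jk.
  have oil := so k i i4 k4 ik ri; have ojl := so k j j4 k4 jk rj.
  move: H; rewrite oil ojl => /(_ isT)/allP H2.
  have /H2/implyP H3 : r l \in link i j.
    by apply: lk; rewrite ?zf ?eqxx // eq_sym ?il ?jl.
  have oik := so l i i4 l4 il ri; have ojk := so l j j4 l4 jl rj.
  by move: H3; rewrite oik ojk hor // => /(_ isT)/andP[/eqP-> /eqP->].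
have : (i = 0 /\ j = 1 \/ i = 0 /\ j = 2 \/ i = 0 /\ j = 3 \/
        i = 1 /\ j = 2 \/ i = 1 /\ j = 3 \/ i = 2 /\ j = 3)%N by lia.
case=> [|[|[|[|[|]]]]] => -[ei ej]; subst i j.
- by have [e1 e2] := key 2 3 isT isT isT isT isT isT => -[|[|[|[|]]]].
- by have [e1 e2] := key 1 3 isT isT isT isT isT isT => -[|[|[|[|]]]].
- by have [e1 e2] := key 1 2 isT isT isT isT isT isT => -[|[|[|[|]]]].
- by have [e1 e2] := key 0 3 isT isT isT isT isT isT => -[|[|[|[|]]]].
- by have [e1 e2] := key 0 2 isT isT isT isT isT isT => -[|[|[|[|]]]].
- by have [e1 e2] := key 0 1 isT isT isT isT isT isT => -[|[|[|[|]]]].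
Qed.

(** Meant for b the vertices of the face that carries a fixed point: the order forces their
    permutation to be trivial. *)
Lemma increasing_fixed (b : nat -> bool) (t : nat -> nat) :
  (forall i, (i < 4)%N -> b i -> (t i < 4)%N /\ b (t i)) ->
  (forall i j, (i < j < 4)%N -> b i -> b j -> (t i < t j)%N) ->
  forall i, (i < 4)%N -> b i -> t i = i.
Proof.
move=> hb ht.
have ge_t i : (i < 4)%N -> b i -> (i <= t i)%N.
  elim/ltn_ind: i => i IH i4 bi; rewrite leqNgt; apply/negP => lt.
  have [t4 bt] := hb i i4 bi.
  have := IH _ lt t4 bt; have := ht (t i) i; rewrite lt i4 => /(_ isT bt bi); lia.
have le_t n i : (4 - i <= n)%N -> (i < 4)%N -> b i -> (t i <= i)%N.
  elim: n i => [|n IH] i hn i4 bi; first by lia.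
  rewrite leqNgt; apply/negP => lt; have [t4 bt] := hb i i4 bi.
  have := IH (t i) ltac:(lia) t4 bt; have := ht i (t i).
  by rewrite lt t4 => /(_ isT bi bt); lia.
by move=> i i4 bi; apply/eqP; rewrite eqn_leq ge_t // (le_t 4) // leq_subr.
Qed.

End IntegerRows.

#[local] Opaque oriented.

(** * Covering the tetrahedron by regions of small displacement *)

Section Covering.
Context {R : realFieldType}.
Implicit Types a b c d : R.

(** With a, b, c, d the weights [tw i q], twice [dispU] and twice [dispV] are
    [chd q (g q) - 3 / 2 * chd q q] for g = [gies1] and [gies2], while 4 times [dispT b a c d] is
    [tco 1 q ^+ 2 - chd q q]; using [chd q q = 1] in this way makes all three homogeneous. *)
Definition dispU a b c d := (b - c + d) ^+ 2 - b * d - a * (b + c + d).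
Definition dispV a b c d := (a - b + c) ^+ 2 - a * c - d * (a + b + c).
Definition dispT b a c d := a ^+ 2 + c ^+ 2 + d ^+ 2 + a * c + a * d + c * d - b * (a + c + d).

Lemma cover_a_max a b c d : 0 <= b -> 0 <= c -> 0 <= d -> b <= a -> c <= a -> d <= a ->
  dispU a b c d <= 0 \/ dispV a b c d <= 0.
Proof.
rewrite /dispU /dispV => b0 c0 d0 ba ca da.
have [dc|cd] := leP d c; first by left; nra.
have [bc|cb] := leP b c; first by left; nra.
have [hA|hA] := leP ((b - c + d) ^+ 2 - b * d - a * (b + c + d)) 0; first by left.
(* With u = b - c, v = d - c and y = a - b, the multipliers u + v of [dispV] and y of [dispU] make
   the terms u y^2, v y^2 and v^2 y cancel; the other monomials in c, u, v, y have nonpositive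
   coefficients. *)
right; rewrite leNgt; apply/negP => hB.
have : 0 < (b + d - 2 * c) * ((a - b + c) ^+ 2 - a * c - d * (a + b + c)).
  by rewrite mulr_gt0 //; lra.
have : 0 <= (a - b) * ((b - c + d) ^+ 2 - b * d - a * (b + c + d)).
  by apply: mulr_ge0; lra.
pose y := a - b; pose u := b - c; pose v := d - c.
have y0 : 0 <= y by rewrite /y; lra.
have u0 : 0 <= u by rewrite /u; lra.
have v0 : 0 <= v by rewrite /v; lra.
have -> : a = c + u + y by rewrite /y /u; ring.
have -> : b = c + u by rewrite /u; ring.
have -> : d = c + v by rewrite /v; ring.
have p1 := mulr_ge0 (mulr_ge0 c0 c0) u0.
have p2 := mulr_ge0 (mulr_ge0 c0 c0) v0.
have p3 := mulr_ge0 (mulr_ge0 c0 c0) y0.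
have p4 := mulr_ge0 (mulr_ge0 c0 u0) u0.
have p5 := mulr_ge0 (mulr_ge0 c0 u0) v0.
have p6 := mulr_ge0 (mulr_ge0 c0 u0) y0.
have p7 := mulr_ge0 (mulr_ge0 c0 v0) y0.
have p8 := mulr_ge0 (mulr_ge0 c0 v0) v0.
have p9 := mulr_ge0 (mulr_ge0 c0 y0) y0.
have p10 := mulr_ge0 (mulr_ge0 u0 u0) u0.
have p11 := mulr_ge0 (mulr_ge0 u0 u0) v0.
have p12 := mulr_ge0 (mulr_ge0 u0 v0) v0.
have p13 := mulr_ge0 (mulr_ge0 u0 v0) y0.
have p14 := mulr_ge0 (mulr_ge0 v0 v0) v0.
have p15 := mulr_ge0 (mulr_ge0 v0 v0) y0.
lra.
Qed.

Lemma cover_b_max a b c d : 0 <= c -> 0 <= d -> c <= a -> d <= b -> a <= b ->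
  dispV a b c d <= 0 \/ dispT b a c d <= 0.
Proof.
rewrite /dispV /dispT => c0 d0 ca db ab.
have [hT|hT] := leP (a ^+ 2 + c ^+ 2 + d ^+ 2 + a * c + a * d + c * d - b * (a + c + d)) 0.
  by right.
left; rewrite leNgt; apply/negP => hB.
have hs : 0 < a + c + d.
  rewrite lt0r; apply/andP; split; last by lra.
  apply/eqP => s0; have [ea ec ed] : [/\ a = 0, c = 0 & d = 0] by split; lra.
  by subst a c d; nra.
(* The multipliers b - a of [dispT] and a + c + d of [dispV] cancel the cubic term in (b - a)^2;
   what is left is minus a nonnegative combination of the products [p1] to [p7]. *)
have : 0 <= (b - a) *
    (a ^+ 2 + c ^+ 2 + d ^+ 2 + a * c + a * d + c * d - b * (a + c + d)).
  by apply: mulr_ge0; lra.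
have : 0 < (a + c + d) * ((a - b + c) ^+ 2 - a * c - d * (a + b + c)) by apply: mulr_gt0.
have p1 : 0 <= (b - a) * c ^+ 2 by apply: mulr_ge0; nra.
have p2 : 0 <= (b - a) * (a * c) by apply: mulr_ge0; nra.
have p3 : 0 <= (b - a) * (a * d) by apply: mulr_ge0; nra.
have p4 : 0 <= (b - a) * (c * d) by apply: mulr_ge0; nra.
have p5 : 0 <= (a + c + d) * (a * d) by apply: mulr_ge0; nra.
have p6 : 0 <= (a + c + d) * (c * (a - c)) by apply: mulr_ge0; nra.
have p7 : 0 <= (a + c + d) * (c * d) by apply: mulr_ge0; nra.
lra.
Qed.

(* In the coordinates a, b, c, d of a point of the tetrahedron, the first two
   inequalities say that the two face pairings move it by at most
   arccosh (3/2), the last two that a unit translation in the cusp at the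
   second, resp. third, vertex does. *)
Lemma tetrahedron_cover a b c d : 0 <= a -> 0 <= b -> 0 <= c -> 0 <= d ->
  [\/ dispU a b c d <= 0, dispV a b c d <= 0, dispT b a c d <= 0 | dispT c a b d <= 0].
Proof.
move=> a0 b0 c0 d0.
(* Reversing the four coordinates exchanges [dispU] and [dispV], so a largest d or c reduces to a
   largest a or b. *)
have Vsym x y z t : dispV x y z t = dispV z y x t by rewrite /dispV; ring.
have Tsym x y z t : dispT y x z t = dispT y z x t by rewrite /dispT; ring.
have UV x y z t : dispU x y z t = dispV t z y x by rewrite /dispU /dispV; ring.
have Trev x y z t : dispT y x z t = dispT y t z x by rewrite /dispT; ring.
have amax (x y z t : R) : 0 <= y -> 0 <= z -> 0 <= t -> y <= x -> z <= x -> t <= x ->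
  dispU x y z t <= 0 \/ dispV x y z t <= 0 by exact: cover_a_max.
have bmax (x y z t : R) : 0 <= x -> 0 <= z -> 0 <= t -> x <= y -> z <= y -> t <= y ->
  dispV x y z t <= 0 \/ dispT y x z t <= 0.
  move=> x0 z0 t0 xy zy ty; have [zx|/ltW xz] := leP z x; first exact: cover_b_max.
  by rewrite Vsym Tsym; apply: cover_b_max.
have pick (x y : R) : x <= y \/ y <= x by have [|/ltW] := leP x y; [left|right].
have caseA : b <= a -> c <= a -> d <= a -> dispU a b c d <= 0 \/ dispV a b c d <= 0 by exact: amax.
have caseD : c <= d -> b <= d -> a <= d -> dispU a b c d <= 0 \/ dispV a b c d <= 0.
  by move=> h1 h2 h3; have := amax d c b a c0 b0 a0 h1 h2 h3; rewrite UV (UV a) => -[]; [right|left].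
have caseB : a <= b -> c <= b -> d <= b -> dispV a b c d <= 0 \/ dispT b a c d <= 0 by exact: bmax.
have caseC : d <= c -> b <= c -> a <= c -> dispU a b c d <= 0 \/ dispT c a b d <= 0.
  move=> h1 h2 h3; have := bmax d c b a d0 b0 a0 h1 h2 h3.
  by rewrite -UV (Trev d).
have max4 : (b <= a /\ c <= a /\ d <= a) \/ (a <= b /\ c <= b /\ d <= b) \/
    (d <= c /\ b <= c /\ a <= c) \/ (c <= d /\ b <= d /\ a <= d).
  have trans x y z : x <= y -> y <= z -> x <= z :> R by exact: le_trans.
  case: (pick a b) (pick c d) => [ab|ba] [cd|dc].
  - by case: (pick b d) => h; [do 3!right|right; left]; do 2?split=> //; exact: trans h.
  - by case: (pick b c) => h; [do 2!right; left|right; left]; do 2?split=> //; exact: trans h.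
  - by case: (pick a d) => h; [do 3!right|left]; do 2?split=> //; exact: trans h.
  - by case: (pick a c) => h; [do 2!right; left|left]; do 2?split=> //; exact: trans h.
case: max4 => [[h1 [h2 h3]]|[[h1 [h2 h3]]|[[h1 [h2 h3]]|[h1 [h2 h3]]]]].
- by case: (caseA h1 h2 h3); [constructor 1|constructor 2].
- by case: (caseB h1 h2 h3); [constructor 2|constructor 3].
- by case: (caseC h1 h2 h3); [constructor 1|constructor 4].
- by case: (caseD h1 h2 h3); [constructor 1|constructor 2].
Qed.

End Covering.

(** * The Gieseking group *)

Section Tetrahedron.
Context {R : realType}.
Local Notation pt := (hpt R 2).
Implicit Types (p q : pt) (g : pt -> pt).

Let s3 : R := Num.sqrt 3.
Let s3E : s3 ^+ 2 = 3. Proof. by rewrite /s3 sqr_sqrtr. Qed.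

(* The rescaled coordinate sqrt 3 * Im z makes both generators rational. *)
Definition im3 p : R := Num.sqrt 3 * Defs.im p.

Let s3_neq0 : s3 != 0.
Proof. by rewrite gt_eqF // /s3 sqrtr_gt0. Qed.

Let imE2 p q : Defs.im p * Defs.im q = im3 p * im3 q / 3.
Proof. by rewrite /im3 -/s3 -[X in _ / X]s3E; field; exact: s3_neq0. Qed.

(* The vertices of the ideal tetrahedron, in the order inf, omega, 1, 0 for
   which both face pairings are increasing on the vertices of the face. *)
Definition tvert (i : nat) : option 'rV[R]_2 :=
  match i with
  | 0 => None
  | 1 => Some (mkrow om_re om_im)
  | 2 => Some (mkrow 1 0)
  | _ => Some (mkrow 0 0)
  end.

Definition tco (i : nat) p : R := ev (bvec (tvert i)) p.

Lemma dot2 (u v : 'rV[R]_2) : dot u v = u 0 ord0 * v 0 ord0 + u 0 ord_max * v 0 ord_max.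
Proof.
rewrite /dot 2!big_ord_recl big_ord0 addr0.
by congr (_ + _ * _); congr (_ 0 _); apply: val_inj.
Qed.

Lemma mkrowE0 (a b : R) : mkrow a b 0 ord0 = a.
Proof. by rewrite mxE. Qed.

Lemma mkrowE1 (a b : R) : mkrow a b 0 ord_max = b.
Proof. by rewrite mxE. Qed.

Lemma tcoE p : let: (x, y, t) := (Defs.re p, im3 p, hy p) in
  [/\ tco 0 p = t^-1, tco 1 p = (x ^+ 2 + y ^+ 2 / 3 + t ^+ 2 - x - y + 1) / t,
      tco 2 p = (x ^+ 2 + y ^+ 2 / 3 + t ^+ 2 - 2 * x + 1) / t &
      tco 3 p = (x ^+ 2 + y ^+ 2 / 3 + t ^+ 2) / t].
Proof.
have y2 : Defs.im p ^+ 2 = im3 p ^+ 2 / 3 by rewrite !expr2 imE2.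
have ht := hy_neq0 p.
split; rewrite /tco /tvert ?ev_bvecN // ev_bvecS dot2 !mxE !eqxx /=; congr (_ / _);
  rewrite -/(Defs.re p) -/(Defs.im p) -!expr2.
- have e : im3 p = s3 * Defs.im p by [].
  rewrite /om_re /om_im -/s3 e.
  have -> : (s3 * Defs.im p) ^+ 2 / 3 = Defs.im p ^+ 2 by rewrite exprMn s3E; field.
  have -> : (Defs.im p - s3 / 2) ^+ 2 = Defs.im p ^+ 2 - s3 * Defs.im p + s3 ^+ 2 / 4 by field.
  by rewrite s3E; field.
- by rewrite subr0 y2; ring.
- by rewrite !subr0 y2.
Qed.

Definition tsum p : R := tco 0 p + tco 1 p + tco 2 p + tco 3 p.

Lemma tco_gt0 i p : 0 < tco i p.
Proof. exact: ev_bvec_gt0. Qed.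

Lemma tco_le i p q : tco i q <= 2 * tco i p * chd p q.
Proof.
rewrite chdC mulrAC.
exact: null_ev_le2 (lform_bvec_self _) (ev_bvec_gt0 _ _) (ev_bvec_gt0 _ _).
Qed.

(** The Gram matrix of the four null vectors is 2 (J - I), with J the all-ones matrix, and its
    inverse J/6 - I/2 gives the coefficients. *)
Lemma chd_tco p q : chd p q = tsum p * tsum q / 6 -
  (tco 0 p * tco 0 q + tco 1 p * tco 1 q + tco 2 p * tco 2 q + tco 3 p * tco 3 q) / 2.
Proof.
have -> : chd p q = 1 + ((Defs.re p - Defs.re q) ^+ 2 + (im3 p - im3 q) ^+ 2 / 3 +
    (hy p - hy q) ^+ 2) / (2 * hy p * hy q).
  rewrite /chd esqdE !dot2 -!/(Defs.re _) -!/(Defs.im _) !imE2; congr (1 + _ / _).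
  by rewrite /Defs.re; field.
rewrite /tsum; have [-> -> -> ->] := tcoE p; have [-> -> -> ->] := tcoE q.
have := hy_neq0 p; have := hy_neq0 q.
by move=> h1 h2; field; rewrite h1 h2.
Qed.

Lemma tco_form p : tsum p ^+ 2 / 6 -
  (tco 0 p ^+ 2 + tco 1 p ^+ 2 + tco 2 p ^+ 2 + tco 3 p ^+ 2) / 2 = 1.
Proof. by rewrite -[RHS](chd_refl p) chd_tco -!expr2. Qed.

Lemma tco_inj p q : tco 0 p = tco 0 q -> tco 1 p = tco 1 q ->
  tco 2 p = tco 2 q -> tco 3 p = tco 3 q -> p = q.
Proof.
move=> e0 e1 e2 e3; apply: chd_le1.
by rewrite chd_tco /tsum e0 e1 e2 e3 -/(tsum q) -!expr2 tco_form.
Qed.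

Lemma tco_surj (a b c d : R) : 0 < a ->
  (a + b + c + d) ^+ 2 / 6 - (a ^+ 2 + b ^+ 2 + c ^+ 2 + d ^+ 2) / 2 = 1 ->
  exists p, [/\ tco 0 p = a, tco 1 p = b, tco 2 p = c & tco 3 p = d].
Proof.
move=> a0 h; have an : a != 0 by rewrite gt_eqF.
pose x := ((d - c) / a + 1) / 2; pose y := (d - b) / a + 1 - x.
have t0 : 0 < a^-1 by rewrite invr_gt0.
pose p : pt := HPt (mkrow x (y * s3 / 3)) t0.
have rp : Defs.re p = x by rewrite /Defs.re /p /= mkrowE0.
have ip : im3 p = y.
  rewrite /im3 /Defs.im /p /= mkrowE1 -/s3 (_ : s3 * _ = y * s3 ^+ 2 / 3); last by ring.
  by rewrite s3E; field.
have tp : hy p = a^-1 by [].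
exists p; have [-> -> -> ->] := tcoE p; rewrite rp ip tp !invrK.
have key : (x ^+ 2 + y ^+ 2 / 3 + a^-1 ^+ 2) * a = d.
  have -> : a^-1 ^+ 2 = a^-1 ^+ 2 *
     ((a + b + c + d) ^+ 2 / 6 - (a ^+ 2 + b ^+ 2 + c ^+ 2 + d ^+ 2) / 2) by rewrite h mulr1.
  by rewrite /y /x; field.
split=> //.
- rewrite -[RHS]addr0 -[0](subrr d) -{1}key /y; field.
  by [].
- rewrite -[RHS]addr0 -[0](subrr d) -{1}key /x; field.
  by [].
Qed.

Lemma isometry_of_chd g : (forall p q, chd (g p) (g q) = chd p q) ->
  (forall q, exists p, g p = q) -> Defs.isometry g.
Proof.
move=> gd /choice[f fK]; split; last by move=> p q; rewrite !hdistE gd.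
exists f => // p; apply: chd_le1.
by rewrite -gd fK chd_refl.
Qed.

(** The face pairing takes the vertices 0, 1, 2 to 0, 2, 3; the mixed row comes from the vertex
    beyond a face of the tetrahedron. *)
Lemma gies1_tco p : [/\ tco 0 (gies1 p) = tco 0 p,
  tco 1 (gies1 p) = tco 0 p + tco 1 p + tco 2 p - tco 3 p,
  tco 2 (gies1 p) = tco 1 p & tco 3 (gies1 p) = tco 2 p].
Proof.
have rg : Defs.re (gies1 p) = (1 - Defs.re p + im3 p) / 2.
  by rewrite /gies1 {1}/Defs.re /= mkrowE0 /om_re /om_im /im3; field.
have ig : im3 (gies1 p) = 3 * (Defs.re p - 1) / 2 + im3 p / 2.
  rewrite {1}/im3 /gies1 {1}/Defs.im /= mkrowE1 /om_re /om_im -/s3.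
  rewrite (_ : s3 * _ = s3 ^+ 2 * (Defs.re p - 1) / 2 + s3 * Defs.im p / 2); last by field.
  by rewrite s3E.
have tg : hy (gies1 p) = hy p by [].
have [-> -> -> ->] := tcoE (gies1 p); rewrite rg ig tg.
have [-> -> -> ->] := tcoE p; have ht := hy_neq0 p.
by split=> //; field.
Qed.

(** This face pairing takes the vertices 0, 1, 3 to 1, 2, 3. *)
Lemma gies2_tco p : [/\ tco 0 (gies2 p) = tco 0 p + tco 1 p - tco 2 p + tco 3 p,
  tco 1 (gies2 p) = tco 0 p, tco 2 (gies2 p) = tco 1 p & tco 3 (gies2 p) = tco 3 p].
Proof.
pose D := (Defs.re p + om_re) ^+ 2 + (- Defs.im p + om_im) ^+ 2 + hy p ^+ 2.
have D0 : D != 0 by rewrite gt_eqF // gies2_den_gt0.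
have y2 : Defs.im p ^+ 2 = im3 p ^+ 2 / 3 by rewrite !expr2 imE2.
have yE : s3 * Defs.im p = im3 p by [].
have DE : D = Defs.re p ^+ 2 + Defs.re p + im3 p ^+ 2 / 3 - im3 p + 1 + hy p ^+ 2.
  have -> : D = Defs.re p ^+ 2 + Defs.re p + 1 / 4 + Defs.im p ^+ 2 - s3 * Defs.im p +
     s3 ^+ 2 / 4 + hy p ^+ 2 by rewrite /D /om_re /om_im -/s3; field.
  by rewrite s3E yE y2; field.
have rg : Defs.re (gies2 p) = ((Defs.re p ^+ 2 + Defs.re p / 2 + im3 p ^+ 2 / 3 - im3 p / 2 +
    hy p ^+ 2) / 2 + im3 p / 4 + 3 / 4 * Defs.re p) / D.
  rewrite /gies2 {1}/Defs.re /= mkrowE0 -/D; congr (_ / _); rewrite /om_re /om_im -/s3.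
  rewrite -y2 -yE.
  transitivity ((Defs.re p ^+ 2 + Defs.re p / 2 + Defs.im p ^+ 2 - s3 * Defs.im p / 2 +
    hy p ^+ 2) / 2 + s3 * Defs.im p / 4 + s3 ^+ 2 / 4 * Defs.re p); first by field.
  by rewrite s3E.
have ig : im3 (gies2 p) = (3 / 2 * (Defs.re p ^+ 2 + Defs.re p / 2 + im3 p ^+ 2 / 3 -
    im3 p / 2 + hy p ^+ 2) - im3 p / 4 - 3 / 4 * Defs.re p) / D.
  rewrite {1}/im3 /gies2 {1}/Defs.im /= mkrowE1 -/D mulrA; congr (_ / _).
  rewrite /om_re /om_im -/s3 -y2 -yE.
  transitivity (s3 ^+ 2 / 2 * (Defs.re p ^+ 2 + Defs.re p / 2 + Defs.im p ^+ 2 -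
    s3 * Defs.im p / 2 + hy p ^+ 2) - s3 * Defs.im p / 4 - s3 ^+ 2 / 4 * Defs.re p); first by field.
  by rewrite s3E.
have tg : hy (gies2 p) = hy p / D by [].
have [-> -> -> ->] := tcoE (gies2 p); rewrite rg ig tg.
have [-> -> -> ->] := tcoE p; have ht := hy_neq0 p.
have D3 : (Defs.re p ^+ 2 + Defs.re p) * 3 + im3 p ^+ 2 + - im3 p * 3 + 3 + hy p ^+ 2 * 3 != 0.
  by rewrite (_ : _ + _ = 3 * D) ?mulf_neq0 // DE; field.
by rewrite DE; split; field; rewrite ht D3.
Qed.


Definition zev (u : zrow) p : R := let: (a, b, c, d) := u in
  a%:~R * tco 0 p + b%:~R * tco 1 p + c%:~R * tco 2 p + d%:~R * tco 3 p.

Lemma zev_ze i p : (i < 4)%N -> zev (ze i) p = tco i p.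
Proof. by move: i => [|[|[|[|i]]]] //= _; rewrite ?mul0r ?mul1r ?addr0 ?add0r. Qed.

Lemma zev_gies1 u p : zev (zU u) p = zev u (gies1 p).
Proof.
case: u => [[[a b] c] d]; rewrite /zev /=; have [-> -> -> ->] := gies1_tco p.
by rewrite !intrD !mulrNz; ring.
Qed.

Lemma zev_gies2 u p : zev (zV u) p = zev u (gies2 p).
Proof.
case: u => [[[a b] c] d]; rewrite /zev /=; have [-> -> -> ->] := gies2_tco p.
by rewrite !intrD !mulrNz; ring.
Qed.

Lemma zU'K u : zU (zU' u) = u.
Proof. by case: u => [[[a b] c] d] /=; congr (_, _, _, _); lia. Qed.

Lemma zV'K u : zV (zV' u) = u.
Proof. by case: u => [[[a b] c] d] /=; congr (_, _, _, _); lia. Qed.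

Lemma zform_gen u v : [/\ zform (zU u) (zU v) = zform u v, zform (zV u) (zV v) = zform u v,
  zform (zU' u) (zU' v) = zform u v & zform (zV' u) (zV' v) = zform u v].
Proof.
by case: u v => [[[a b] c] d] [[[a' b'] c'] d'] /=; split; ring.
Qed.

Lemma gies1_isometry : Defs.isometry (@gies1 R).
Proof.
apply: isometry_of_chd => [p q|q].
  rewrite !chd_tco /tsum; have [-> -> -> ->] := gies1_tco p.
  by have [-> -> -> ->] := gies1_tco q; field.
have [|p [e0 e1 e2 e3]] := @tco_surj (tco 0 q) (tco 2 q) (tco 3 q)
    (tco 0 q + tco 2 q + tco 3 q - tco 1 q) (tco_gt0 0 q).
  by rewrite -[RHS](tco_form q) /tsum; field.
exists p; have [f0 f1 f2 f3] := gies1_tco p.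
by apply: tco_inj; rewrite ?f0 ?f1 ?f2 ?f3 ?e0 ?e1 ?e2 ?e3 //; ring.
Qed.

Lemma gies2_isometry : Defs.isometry (@gies2 R).
Proof.
apply: isometry_of_chd => [p q|q].
  rewrite !chd_tco /tsum; have [-> -> -> ->] := gies2_tco p.
  by have [-> -> -> ->] := gies2_tco q; field.
have [|p [e0 e1 e2 e3]] := @tco_surj (tco 1 q) (tco 2 q)
    (tco 1 q + tco 2 q + tco 3 q - tco 0 q) (tco 3 q) (tco_gt0 1 q).
  by rewrite -[RHS](tco_form q) /tsum; field.
exists p; have [f0 f1 f2 f3] := gies2_tco p.
by apply: tco_inj; rewrite ?f0 ?f1 ?f2 ?f3 ?e0 ?e1 ?e2 ?e3 //; ring.
Qed.

Definition acts_on_rows g := exists A : zrow -> zrow,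
  [/\ forall u p, zev (A u) p = zev u (g p),
      forall u v, zform (A u) (A v) = zform u v &
      forall u v, oriented u v -> oriented (A u) (A v)].

Definition lattice_isometry g := Defs.isometry g /\
  exists f, [/\ cancel f g, cancel g f, acts_on_rows g & acts_on_rows f].

Lemma acts_on_rows_comp f g : acts_on_rows f -> acts_on_rows g -> acts_on_rows (f \o g).
Proof.
move=> [A [a1 a2 a3]] [B [b1 b2 b3]]; exists (B \o A); split=> u p /=.
- by rewrite b1 a1.
- by rewrite b2 a2.
- by move=> /a3/b3.
Qed.

Lemma lattice_isometry_gies1 : lattice_isometry (@gies1 R).
Proof.
split; first exact: gies1_isometry.
have [[f fK gK] _] := gies1_isometry; exists f; split=> //.
  exists zU; split=> [u p|u v|u v]; first exact: zev_gies1.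
    by have [] := zform_gen u v.
  by move=> /oriented_gen[].
exists zU'; split=> [u p|u v|u v].
- by rewrite -[in LHS](gK p) -zev_gies1 zU'K.
- by have [] := zform_gen u v.
- by move=> /oriented_gen[].
Qed.

Lemma lattice_isometry_gies2 : lattice_isometry (@gies2 R).
Proof.
split; first exact: gies2_isometry.
have [[f fK gK] _] := gies2_isometry; exists f; split=> //.
  exists zV; split=> [u p|u v|u v]; first exact: zev_gies2.
    by have [] := zform_gen u v.
  by move=> /oriented_gen[].
exists zV'; split=> [u p|u v|u v].
- by rewrite -[in LHS](gK p) -zev_gies2 zV'K.
- by have [] := zform_gen u v.
- by move=> /oriented_gen[].
Qed.

Lemma isometry_comp f g : Defs.isometry f -> Defs.isometry g -> Defs.isometry (f \o g).
Proof.
move=> [bf df] [bg dg]; split; first exact: bij_comp.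
by move=> p q; rewrite /= df dg.
Qed.

Lemma gieseking_lattice g : gieseking_group g -> lattice_isometry g.
Proof.
apply; first last.
- move=> a b [ia [f [fK aK ra rf]]] ba ab.
  have -> : b = f.
    apply/funext => p; rewrite -[in LHS](fK p).
    by rewrite -[LHS]/((b \o a) (f p)) ba.
  split; first exact: isometry_inv ia fK aK.
  by exists a; split.
- move=> a b [ia [f [fK aK ra rf]]] [ib [h [hK bK rb rh]]].
  split; first exact: isometry_comp.
  exists (h \o f); split; [exact: can_comp|exact: can_comp| |]; exact: acts_on_rows_comp.
- by move=> g' [->|->]; [exact: lattice_isometry_gies1|exact: lattice_isometry_gies2].
- split; first by split=> //; exists id.
  by exists id; split=> //; exists id.
Qed.

Lemma gieseking_id : gieseking_group (id : pt -> pt).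
Proof. by move=> G G1 _ _ _. Qed.

Lemma gieseking_comp f g : gieseking_group f -> gieseking_group g ->
  @gieseking_group R (f \o g).
Proof. by move=> hf hg G G1 Gs Gc Gi; apply: (Gc); [exact: hf|exact: hg]. Qed.

Lemma gieseking_inv f g : gieseking_group g -> cancel f g -> cancel g f ->
  @gieseking_group R f.
Proof.
move=> hg fK gK G G1 Gs Gc Gi; apply: (Gi g); first exact: hg.
  by apply/funext => p /=; rewrite gK.
by apply/funext => p /=; rewrite fK.
Qed.

Lemma gieseking_gies1 : gieseking_group (@gies1 R).
Proof. by move=> G _ Gs _ _; apply: Gs; left. Qed.

Lemma gieseking_gies2 : gieseking_group (@gies2 R).
Proof. by move=> G _ Gs _ _; apply: Gs; right. Qed.

Lemma gieseking_isom_group : isom_group (@gieseking_group R).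
Proof.
split; last by move=> g /gieseking_lattice[].
split; first exact: gieseking_id.
split=> [g h|g Gg]; first exact: gieseking_comp.
have [_ [f [fK gK _ _]]] := gieseking_lattice Gg; exists f.
split; first exact: gieseking_inv Gg fK gK.
by split; apply/funext => p /=; rewrite ?gK ?fK.
Qed.

End Tetrahedron.

(** * Reduction to the tetrahedron, freeness and the injectivity radius *)

Section GiesekingManifold.
Context {R : realType}.
Local Notation pt := (hpt R 2).
Local Notation G := (@gieseking_group R).
Implicit Types (p q : pt) (g : pt -> pt).

Let chd_isom g p q : G g -> chd (g p) (g q) = chd p q.
Proof. by move=> /gieseking_lattice[[_ gd] _]; apply: hdist_eq_chd. Qed.

(* The coordinates of p in the basis of null vectors at the vertices of the
   tetrahedron. *)
Definition tw (i : nat) p : R := tsum p / 6 - tco i p / 2.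

Lemma chd_tw p q : chd p q =
  tw 0 p * tco 0 q + tw 1 p * tco 1 q + tw 2 p * tco 2 q + tw 3 p * tco 3 q.
Proof. by rewrite chd_tco /tw /tsum; field. Qed.

Lemma center_exists : exists (c : R) (o : pt), 0 < c /\ forall i, (i < 4)%N -> tco i o = c.
Proof.
have c0 : 0 < Num.sqrt (3 / 2 : R) by rewrite sqrtr_gt0 divr_gt0.
have cE : Num.sqrt (3 / 2 : R) ^+ 2 = 3 / 2 by rewrite sqr_sqrtr // divr_ge0.
have [|o [e0 e1 e2 e3]] := @tco_surj R _ (Num.sqrt (3 / 2)) (Num.sqrt (3 / 2)) (Num.sqrt (3 / 2)) c0.
  set c := Num.sqrt _ in cE *.
  rewrite (_ : _ - _ = 2 / 3 * c ^+ 2); last by field.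
  by rewrite cE; field.
by exists (Num.sqrt (3 / 2)), o; split=> // -[|[|[|[|i]]]].
Qed.

Context (c : R) (o : pt) (c0 : 0 < c) (oE : forall i, (i < 4)%N -> tco i o = c).

Lemma zev_center u : zev u o = c * (zsum u)%:~R.
Proof. by case: u => [[[x y] z] w] /=; rewrite !oE // !intrD; ring. Qed.

(** The four horofunctions agree at the center, so an integer row takes there an integer multiple of
    c, positive for a horofunction. This discreteness lets a minimum over the orbit be attained. *)
Lemma tco_orbit_center g i : G g -> (i < 4)%N ->
  exists n : nat, (0 < n)%N /\ tco i (g o) = c * n%:R.
Proof.
move=> /gieseking_lattice[_ [_ [_ _ [A [a1 _ _]] _]]] i4.
have e : tco i (g o) = c * (zsum (A (ze i)))%:~R by rewrite -zev_center a1 zev_ze.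
have := tco_gt0 i (g o); rewrite e pmulr_rgt0 // ltr0z.
by case: (zsum _) e => // n e n0; exists n; split.
Qed.

(** Membership in the Dirichlet domain of the group at the center o. *)
Definition reduced p := forall h, G h -> chd p o <= chd p (h o).

(* The values of chd p on the orbit of the center are determined by four
   natural numbers, boundedly many of which keep chd p small. *)
Lemma reduced_exists p : exists g, G g /\ reduced (g p).
Proof.
pose s := chd p o.
(* By [tco_le], an orbit point at most as far from p as o has horofunction values at most
   [2 * tsum p * s]. *)
pose N := Num.truncn (2 * tsum p * s / c).
pose P (b : {ffun 'I_4 -> 'I_N.+1}) :=
  `[< exists g, G g /\ forall i : 'I_4, tco i (g o) = c * (b i)%:R >].
pose vl (b : {ffun 'I_4 -> 'I_N.+1}) : R := \sum_(i < 4) tw i p * (c * (b i)%:R).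
have valE (b : {ffun 'I_4 -> 'I_N.+1}) g : (forall i : 'I_4, tco i (g o) = c * (b i)%:R) -> chd p (g o) = vl b.
  move=> h; rewrite chd_tw /vl !big_ord_recl big_ord0 addr0 !addrA.
  by rewrite -!h.
have tle i : (i < 4)%N -> tco i p <= tsum p.
  have := (tco_gt0 0 p, tco_gt0 1 p, tco_gt0 2 p, tco_gt0 3 p) => -[[[h0 h1] h2] h3].
  by rewrite /tsum; move: i => [|[|[|[|i]]]] // _; lra.
have s1 : 1 <= s by exact: chd_ge1.
have repr g : G g -> chd p (g o) <= s -> exists b, P b /\ vl b = chd p (g o).
  move=> Gg le; have ex i (i4 : (i < 4)%N) := tco_orbit_center Gg i4.
  have /choice[n hn] (i : 'I_4) : exists n : nat, (0 < n)%N /\ tco i (g o) = c * n%:R by exact: ex.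
  have hN i : (n i < N.+1)%N.
    have [_ e] := hn i; have i4 := ltn_ord i.
    have ts : 0 < tsum p by apply: lt_le_trans (tco_gt0 0 p) (tle 0 _).
    rewrite ltnS /N truncn_ge_nat; last by rewrite divr_ge0 ?mulr_ge0 ?ltW //; lra.
    rewrite ler_pdivlMr // mulrC -e.
    apply: le_trans (tco_le i p (g o)) _.
    have c1 := chd_ge1 p (g o); apply: ler_pM => //; last by rewrite ler_pM2l // tle.
      by rewrite mulr_ge0 // ltW // tco_gt0.
    by lra.
  exists [ffun i => Ordinal (hN i)]; split.
    by apply/asboolP; exists g; split=> // i; rewrite ffunE; have [] := hn i.
  by symmetry; apply: valE => i; rewrite ffunE; have [] := hn i.
have [b0 [Pb0 vb0]] := repr id (gieseking_id) (lexx _).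
case: (@arg_minP _ _ _ b0 P vl Pb0) => b /asboolP[g [Gg hg]] bmin.
have gmin h : G h -> chd p (g o) <= chd p (h o).
  move=> Gh; rewrite (valE b) //; have [le|lt] := leP (chd p (h o)) s.
    by have [b' [Pb' <-]] := repr h Gh le; exact: bmin.
  by apply: ltW; apply: le_lt_trans (bmin b0 Pb0) _; rewrite vb0.
have [_ [f [fK gK _ _]]] := gieseking_lattice Gg.
have Gf := gieseking_inv Gg fK gK.
exists f; split=> // h Gh.
rewrite -[in leLHS](gK o) chd_isom // -[in leRHS](gK (h o)) chd_isom //.
exact: (gmin (g \o h) (gieseking_comp Gg Gh)).
Qed.

(** The center of the tetrahedron across a face has one horofunction value 2 c and three values c,
    so minimality against it reads [0 <= c * tw i p]. *)
Lemma reduced_tw p : reduced p -> [/\ 0 <= tw 0 p, 0 <= tw 1 p, 0 <= tw 2 p & 0 <= tw 3 p].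
Proof.
move=> red.
have key h : G h -> 0 <= tw 0 p * (tco 0 (h o) - c) + tw 1 p * (tco 1 (h o) - c) +
    tw 2 p * (tco 2 (h o) - c) + tw 3 p * (tco 3 (h o) - c).
  move=> Gh; have := red h Gh; rewrite (chd_tw p o) (chd_tw p (h o)) !oE // -subr_ge0.
  by congr (_ <= _); ring.
have inv g : G g -> exists f, [/\ G f, cancel f g & cancel g f].
  move=> Gg; have [_ [f [fK gK _ _]]] := gieseking_lattice Gg.
  by exists f; split=> //; exact: gieseking_inv Gg fK gK.
have [f1 [Gf1 fK1 gK1]] := inv _ gieseking_gies1.
have [f2 [Gf2 fK2 gK2]] := inv _ gieseking_gies2.
have h1 := key _ gieseking_gies1; have h2 := key _ gieseking_gies2.
have h3 := key _ Gf1; have h4 := key _ Gf2.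
have [a0 a1 a2 a3] := gies1_tco o; have [b0 b1 b2 b3] := gies2_tco o.
have [d0 d1 d2 d3] := gies1_tco (f1 o); have [e0 e1 e2 e3] := gies2_tco (f2 o).
rewrite fK1 !oE // in d0 d1 d2 d3; rewrite fK2 !oE // in e0 e1 e2 e3.
rewrite !oE // in a0 a1 a2 a3 b0 b1 b2 b3.
have d3' : tco 3 (f1 o) = 2 * c by lra.
have e2' : tco 2 (f2 o) = 2 * c by lra.
split.
- by rewrite -(pmulr_lge0 _ c0); move: h2; rewrite b0 b1 b2 b3; congr (_ <= _); ring.
- by rewrite -(pmulr_lge0 _ c0); move: h1; rewrite a0 a1 a2 a3; congr (_ <= _); ring.
- by rewrite -(pmulr_lge0 _ c0); move: h4; rewrite -e1 -e2 e2' -e3; congr (_ <= _); ring.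
- by rewrite -(pmulr_lge0 _ c0); move: h3; rewrite -d0 -d2 -d3 d3'; congr (_ <= _); ring.
Qed.

Lemma tw_tco i p : tco i p = 2 * (tw 0 p + tw 1 p + tw 2 p + tw 3 p - tw i p).
Proof. by rewrite /tw /tsum; field. Qed.

(** As g fixes p, [g o] is as far from p as o. Nonnegative weights and values at least c force the
    value c at each vertex of positive weight, whose row is then a vertex by [zform_unit], of the
    same weight. So the vertices of positive weight are permuted, in an order-preserving way. *)
Lemma reduced_free g p : reduced p -> G g -> g p = p -> g = id.
Proof.
move=> red Gg gp; have [w0 w1 w2 w3] := reduced_tw red.
have w_ge0 i : (i < 4)%N -> 0 <= tw i p by move: i => [|[|[|[|i]]]].
have [_ [_ [_ _ [A [a1 a2 a3]] _]]] := gieseking_lattice Gg.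
pose r i := A (ze i).
have rE i q : (i < 4)%N -> tco i (g q) = zev (r i) q by move=> i4; rewrite a1 zev_ze.
have supp i : (i < 4)%N -> 0 < tw i p -> exists k, [/\ (k < 4)%N, r i = ze k & 0 < tw k p].
  move=> i4 wi.
  have ge_c j : (j < 4)%N -> 0 <= tco j (g o) - c.
    move=> j4; have [n [n0 ->]] := tco_orbit_center Gg j4.
    by rewrite subr_ge0 ler_peMr ?ler1n // ltW.
  have sum0 : tw 0 p * (tco 0 (g o) - c) + tw 1 p * (tco 1 (g o) - c) +
      tw 2 p * (tco 2 (g o) - c) + tw 3 p * (tco 3 (g o) - c) = 0.
    have : chd p (g o) = chd p o by rewrite -{1}gp chd_isom.
    by rewrite !chd_tw !oE // => e; lra.
  have t0 j : (j < 4)%N -> 0 <= tw j p * (tco j (g o) - c).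
    by move=> j4; rewrite mulr_ge0 ?w_ge0 ?ge_c.
  have t00 := t0 0%N isT; have t10 := t0 1%N isT.
  have t20 := t0 2%N isT; have t30 := t0 3%N isT.
  have /eqP : tw i p * (tco i (g o) - c) = 0.
    by move: i i4 {wi} => [|[|[|[|i]]]] // _; lra.
  rewrite mulf_eq0 gt_eqF //= subr_eq0 => /eqP e.
  have : zsum (r i) = 1.
    have cn : c != 0 by rewrite gt_eqF.
    have h : (zsum (r i))%:~R = 1 :> R.
      by apply: (mulfI cn); rewrite -zev_center -rE // e mulr1.
    by apply/eqP; rewrite -(eqr_int R) h.
  have rr : zform (r i) (r i) = 0 by rewrite a2; move: i i4 {wi e} => [|[|[|[|i]]]].
  move=> /zform_unit/(_ rr)[k k4 rk]; exists k; split=> //.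
  have : tco i p = tco k p by rewrite -{1}gp rE // rk zev_ze.
  by move: wi; rewrite /tw => + e1; rewrite e1.
have /choice[t ht] i : exists k, (i < 4)%N -> 0 < tw i p ->
    [/\ (k < 4)%N, r i = ze k & 0 < tw k p].
  have [i4|i4] := pselect (i < 4)%N; last by exists 0%N => /i4.
  have [wi|wi] := pselect (0 < tw i p); last by exists 0%N => _ /wi.
  by have [k hk] := supp i i4 wi; exists k.
have fixed i : (i < 4)%N -> 0 < tw i p -> r i = ze i.
  move=> i4 wi; have [_ -> _] := ht i i4 wi; congr ze.
  apply: (@increasing_fixed (fun i => 0 < tw i p) t) => // [j j4 wj|j k /andP[jk k4] wj wk].
    by have [] := ht j j4 wj.
  have j4 := ltn_trans jk k4.
  have [tj4 rj _] := ht j j4 wj; have [tk4 rk _] := ht k k4 wk.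
  by rewrite -(oriented_ze tj4 tk4) -rj -rk; apply: a3; rewrite (oriented_ze j4 k4).
(* With at most one nonzero weight, p would be null or zero, against [chd p p = 1]. *)
have [i [j [ij ri rj]]] : exists i j, [/\ (i < j < 4)%N, r i = ze i & r j = ze j].
  have e := chd_refl p; rewrite chd_tw !(tw_tco _ p) in e.
  have dich i : (i < 4)%N -> tw i p = 0 \/ 0 < tw i p.
    by move=> i4; have := w_ge0 i i4; rewrite le_eqVlt => /orP[/eqP<-|]; [left|right].
  case: (dich 0%N isT) => [z0|p0]; case: (dich 1%N isT) => [z1|p1];
  case: (dich 2%N isT) => [z2|p2]; case: (dich 3%N isT) => [z3|p3];
  first [ by exists 0%N, 1%N; split=> //; apply: fixed
        | by exists 0%N, 2%N; split=> //; apply: fixed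
        | by exists 0%N, 3%N; split=> //; apply: fixed
        | by exists 1%N, 2%N; split=> //; apply: fixed
        | by exists 1%N, 3%N; split=> //; apply: fixed
        | by exists 2%N, 3%N; split=> //; apply: fixed
        | exfalso; move: e; rewrite ?z0 ?z1 ?z2 ?z3; lra ].
have all_fixed := @rows_of_edge r i j (fun k l _ _ => a2 _ _) _ ij ri rj.
have {}all_fixed : forall k, (k < 4)%N -> r k = ze k.
  apply: all_fixed => k l /andP[kl l4]; apply: a3.
  by rewrite (oriented_ze (ltn_trans kl l4) l4).
by apply/funext => q; apply: tco_inj; rewrite rE // all_fixed // zev_ze.
Qed.

Lemma gieseking_free g p : G g -> g p = p -> g = id.
Proof.
move=> Gg gp; have [k [Gk red]] := reduced_exists p.
have [_ [f [fK kK _ _]]] := gieseking_lattice Gk.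
have Gf := gieseking_inv Gk fK kK.
have e : k \o (g \o f) = id.
  apply: (reduced_free red); first by do 2!apply: gieseking_comp => //.
  by rewrite /= kK gp.
apply/funext => q; have /(congr1 f) := congr1 (@^~ (k q)) e.
by rewrite /= !kK.
Qed.

(** The tangency point of the unit horoballs at the vertices 0 and 1; the values 2 are the means of
    the pairings with these two. *)
Lemma edge_midpoint : exists p, [/\ tco 0 p = 1 :> R, tco 1 p = 1, tco 2 p = 2 & tco 3 p = 2].
Proof. by apply: tco_surj => //; field. Qed.

(** At the edge midpoint all integer rows take integer values, so [chd p (g p)] is a half-integer;
    exceeding 1, it is at least 3/2. *)
Lemma gieseking_rinj_ge : exists p, ((acosh (Num.sqrt 5 / 2 : R))%:E <= rinj G p)%E.
Proof.
have [p [e0 e1 e2 e3]] := edge_midpoint; exists p; apply: (rinj_ge gieseking_isom_group) => g Gg.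
have [/(gieseking_free Gg) ->|ne] := pselect (g p = p); [by left|right].
have [_ [_ [_ _ [A [a1 _ _]] _]]] := gieseking_lattice Gg.
have zevp u : exists n : int, zev u p = n%:~R.
  case: u => [[[x y] z] w]; exists (x + y + z * 2 + w * 2).
  by rewrite /= e0 e1 e2 e3 !intrD !intrM !mulr1.
have e : chd p (g p) = (tco 0 (g p) + tco 1 (g p)) / 2.
  by rewrite chd_tco /tsum e0 e1 e2 e3; field.
have gt1 : 1 < chd p (g p) by rewrite ltNge; apply/negP => /chd_le1 h; apply: ne.
have [n0 h0] := zevp (A (ze 0)); have [n1 h1] := zevp (A (ze 1)).
rewrite -(@zev_ze R 0) // -(@zev_ze R 1) // -!a1 h0 h1 -intrD in e.
have : (3%:Z)%:~R <= (n0 + n1)%:~R :> R.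
  rewrite ler_int; suff : (2%:Z)%:~R < (n0 + n1)%:~R :> R by rewrite ltr_int; lia.
  by rewrite -[(2%:Z)%:~R]/(2 : R); lra.
by rewrite -[(3%:Z)%:~R]/(3 : R); lra.
Qed.

Let G1 := @gieseking_gies1 R.
Let G2 := @gieseking_gies2 R.

Let gies1_moves q : @gies1 R q <> q.
Proof.
move=> /(gieseking_free G1) e; have [p [e0 e1 e2 e3]] := edge_midpoint.
by have [_ _ + _] := gies1_tco p; rewrite e /= e1 e2; lra.
Qed.

Let gies2_moves q : @gies2 R q <> q.
Proof.
move=> /(gieseking_free G2) e; have [p [e0 e1 e2 e3]] := edge_midpoint.
by have [_ _ + _] := gies2_tco p; rewrite e /= e1 e2; lra.
Qed.

Let gies22_moves q : @gies2 R (gies2 q) <> q.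
Proof.
move=> /(gieseking_free (gieseking_comp G2 G2)) e; have [p [e0 e1 e2 e3]] := edge_midpoint.
have [_ _ h _] := gies2_tco (gies2 p); have [_ h' _ _] := gies2_tco p.
by move: h; rewrite h' -[gies2 (gies2 p)]/((gies2 \o gies2) p) e /= e0 e2; lra.
Qed.

(** The analogue of 1 + 1/(2 t^2) for a unit translation at infinity; the value is at most 3/2
    exactly on the closed unit horoball at the vertex 3. *)
Lemma chd_gies22 q : chd q (gies2 (gies2 q)) = 1 + tco 3 q ^+ 2 / 2.
Proof.
rewrite -[X in X + _](tco_form q) chd_tco /tsum.
have [-> -> -> ->] := gies2_tco (gies2 q); have [-> -> -> ->] := gies2_tco q.
by field.
Qed.

(* A conjugate of the parabolic gies2 \o gies2, which translates by 1 along the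
   unit horosphere at the vertex 0. *)
Lemma translation_le k q : G k -> tco 3 (k q) <= 1 ->
  exists g, [/\ G g, forall x, g x <> x & chd q (g q) <= 3 / 2].
Proof.
move=> Gk le1; have [_ [f [fK kK _ _]]] := gieseking_lattice Gk.
have Gf := gieseking_inv Gk fK kK.
exists (f \o (gies2 \o (gies2 \o k))); split.
- by do 3!apply: gieseking_comp => //.
- by move=> x /= /(congr1 k); rewrite fK => /gies22_moves.
- rewrite /= -(chd_isom _ _ Gk) fK chd_gies22.
  have := tco_gt0 3 (k q); nra.
Qed.

Lemma reduced_displacement q : reduced q ->
  exists g, [/\ G g, forall x, g x <> x & chd q (g q) <= 3 / 2].
Proof.
move=> red; have [w0 w1 w2 w3] := reduced_tw red.
have form := chd_refl q; rewrite chd_tw !(tw_tco _ q) in form.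
have [u1 u2 u3 u4] := gies1_tco q; have [v1 v2 v3 v4] := gies2_tco q.
have tc := tw_tco ^~ q.
case: (tetrahedron_cover w0 w1 w2 w3); rewrite /dispU /dispV /dispT => h.
- exists gies1; split=> //; rewrite chd_tw u1 u2 u3 u4 !tc; lra.
- exists gies2; split=> //; rewrite chd_tw v1 v2 v3 v4 !tc; lra.
(* [gies1] takes the vertex 1 to 2 and 2 to 3, so its square, here, and [gies1] itself, in the last
   case, bring the relevant cusp to the vertex 3. *)
- apply: (@translation_le (gies1 \o gies1)); first exact: gieseking_comp.
  have [_ _ _ ->] := gies1_tco (gies1 q); rewrite u3.
  have := tco_gt0 1 q; have := tc 1%N; nra.
- apply: (@translation_le gies1) => //; rewrite u4.
  have := tco_gt0 2 q; have := tc 2%N; nra.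
Qed.

Lemma gieseking_rinj_le p : (rinj G p <= (acosh (Num.sqrt 5 / 2 : R))%:E)%E.
Proof.
have [k [Gk red]] := reduced_exists p.
have [g [Gg moves le]] := reduced_displacement red.
have [_ [f [fK kK _ _]]] := gieseking_lattice Gk.
have Gf := gieseking_inv Gk fK kK.
apply: (@rinj_le _ _ _ (gieseking_isom_group) p (f \o (g \o k))).
- by do 2!apply: gieseking_comp => //.
- by move=> x /= /(congr1 k); rewrite fK => /moves.
- by rewrite /= -(chd_isom _ _ Gk) fK.
Qed.

End GiesekingManifold.

Theorem theorem3 :
  (forall (R : realType) (n : nat) (G : set (hpt R n.-1 -> hpt R n.-1)),
     (2 <= n)%N ->
     isom_group G -> discrete_group G -> torsion_free G -> finite_volume G ->
     ~ compact_quotient G ->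
     forall xi0 B0, cusp_region G xi0 B0 ->
     forall p, tangency_point G xi0 B0 p ->
       (rinj G p <= maxrad G)%E /\
       ((acosh (Num.sqrt 5 / 2 : R))%:E <= rinj G p)%E)
  /\
  (forall R : realType,
     maxrad (@gieseking_group R) = (acosh (Num.sqrt 5 / 2 : R))%:E /\
     forall xi0 B0, cusp_region (@gieseking_group R) xi0 B0 ->
     forall p, tangency_point (@gieseking_group R) xi0 B0 p ->
       rinj (@gieseking_group R) p = (acosh (Num.sqrt 5 / 2 : R))%:E).
Proof.
split=> [R n G _ isomG discG tfG _ _ xi0 B0 cB p tp|R].
  split; first by apply: ereal_sup_ubound; exists p.
  exact: (tangency_rinj_ge isomG (discrete_torsion_free_free isomG discG tfG) cB tp).
have [c [z [c0 zE]]] := @center_exists R.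
have le := gieseking_rinj_le c0 zE.
split=> [|xi0 B0 cB p tp]; apply: le_anti; apply/andP; split=> //.
- by apply: ge_ereal_sup => _ [p _ <-].
- have [p hp] := gieseking_rinj_ge c0 zE.
  by apply: (le_trans hp); apply: ereal_sup_ubound; exists p.
- apply: (tangency_rinj_ge gieseking_isom_group _ cB tp) => g q.
  exact: (gieseking_free c0 zE).
Qed.
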